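(* The Cayley set $\mathfrak{C}$ is a connected complex manifold of dimension $9$.
   Context: A conic in $\mathbb{CP}^2$ is identified with its symmetric $3\times 3$ complex matrix up to a non-zero scalar, so conics form $\mathbb{CP}^5$. $\mathfrak{U}\subset\mathbb{CP}^5$ is the open set of non-degenerate conics ($\det\neq 0$). $\mathfrak{O}\subset \mathfrak{U}\times\mathfrak{U}$ is the open set of pairs $(C,D)$ of non-degenerate conics that intersect transversely, i.e. in four distinct points. Write $\det(tC+D)=\sigma_{3,0}t^3+\sigma_{2,1}t^2+\sigma_{1,2}t+\sigma_{0,3}$ and let $\sqrt{\det(tC+D)}=A_0+A_1t+A_2t^2+\cdots$ be the Taylor expansion at $t=0$ (for a branch of the square root near $\det D\neq 0$). The Cayley set (for triangles) is $\mathfrak{C}=\{(C,D)\in\mathfrak{O}: A_2=0\}$, equivalently the set of $(C,D)\in\mathfrak{O}$ with $-\sigma_{1,2}^2+4\sigma_{0,3}\sigma_{2,1}=0$. It is considered as a subset of $\mathbb{CP}^5\times\mathbb{CP}^5$ in the classical topology, with the induced complex structure. *)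

(* Defs.v *)
From HB Require Import structures.
From mathcomp Require Import all_boot all_order all_algebra generic_quotient.
From mathcomp Require Import complex.
From mathcomp Require Import all_classical all_reals all_analysis.

Set Implicit Arguments.
Unset Strict Implicit.
Unset Printing Implicit Defensive.

Import Order.TTheory GRing.Theory Num.Theory.
Import numFieldNormedType.Exports.

Local Open Scope classical_set_scope.
Local Open Scope card_scope.
Local Open Scope ring_scope.
Local Open Scope quotient_scope.

(* Packing R[i] as a [numClosedFieldType] makes the analysis library see the
   topology and the normed-module structures of the complex numbers, so that
   [derivable] and [differentiable] below mean complex differentiability. *)
Definition complexes (R : realType) : numClosedFieldType := R[i].

Section ComplexManifolds.
Variable R : realType.
Local Notation C := (complexes R).

Record chart (M : Type) (n : nat) := Chart {
  chart_dom : set M;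
  chart_map :> M -> 'rV[C]_n }.

(* The chart is a homeomorphism of its open domain onto an open subset of C^n;
   the values of the map outside of the domain are irrelevant. *)
Definition is_chart (M : topologicalType) n (phi : chart M n) : Prop :=
  [/\ open (chart_dom phi),
      {in chart_dom phi &, injective phi},
      {in chart_dom phi, continuous phi} &
      forall U, open U -> U `<=` chart_dom phi -> open (phi @` U)].

(* [f] is the transition map psi \o phi^-1, holomorphic on the open set
   phi (dom phi `&` dom psi). *)
Definition holomorphic_transition (M : Type) n (phi psi : chart M n) : Prop :=
  exists f : 'rV[C]_n -> 'rV[C]_n,
    forall x, (chart_dom phi `&` chart_dom psi) x ->
      f (phi x) = psi x /\ differentiable f (phi x).

Definition compatible (M : Type) n (phi psi : chart M n) : Prop :=
  holomorphic_transition phi psi /\ holomorphic_transition psi phi.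

Definition complex_manifold (M : topologicalType) n (A : set (chart M n)) :
    Prop :=
  [/\ hausdorff_space M,
      @second_countable M,
      (forall phi, A phi -> is_chart phi),
      (forall phi psi, A phi -> A psi -> compatible phi psi) &
      (forall x, exists2 phi, A phi & chart_dom phi x)].

Definition maximal_atlas (M : topologicalType) n (A : set (chart M n)) :
    set (chart M n) :=
  [set phi | is_chart phi /\ forall psi, A psi -> compatible phi psi].

(* Charts of the ambient manifold that flatten S to C^d x {0}. *)
Definition slice_chart (M : topologicalType) d m (A : set (chart M (d + m)))
    (S : set M) : set (chart M (d + m)) :=
  [set phi | maximal_atlas A phi /\
     phi @` (chart_dom phi `&` S) =
     phi @` chart_dom phi `&` [set v | rsubmx v = 0]].

Definition restrict_chart (M : Type) d m (S : set M) (phi : chart M (d + m)) :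
    chart S d :=
  Chart (set_val @^-1` chart_dom phi)
        (fun x : S => lsubmx (phi (set_val x))).

(* The complex structure that S inherits from M as a submanifold of dimension
   d; it covers S exactly when S is such a submanifold.  S itself is seen as
   the type [set_type S], with the subspace topology. *)
Definition induced_atlas (M : topologicalType) d m
    (A : set (chart M (d + m))) (S : set M) : set (chart S d) :=
  restrict_chart S @` slice_chart A S.

Definition prod_chart (M N : Type) m n (phi : chart M m) (psi : chart N n) :
    chart (M * N) (m + n) :=
  Chart (chart_dom phi `*` chart_dom psi)
        (fun x => row_mx (phi x.1) (psi x.2)).

Definition prod_atlas (M N : Type) m n
    (A : set (chart M m)) (B : set (chart N n)) :
    set (chart (M * N) (m + n)) :=
  [set prod_chart phi psi | phi in A & psi in B].

End ComplexManifolds.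

Section Projectivization.
Variables (R : realType) (m n : nat).
Local Notation C := (complexes R).
Variable W : set 'M[C]_(m, n).

Definition nonzero_vectors : set 'M[C]_(m, n) := [set v | W v /\ v <> 0].

Definition proportional (u v : nonzero_vectors) : bool :=
  `[< exists2 k : C, k != 0 & set_val u = k *: set_val v >].

Lemma proportional_equiv : equiv_class_of proportional.
Proof.
split.
- by move=> u; apply/asboolP; exists 1; rewrite ?oner_neq0 ?scale1r.
- have sym u v : proportional u v -> proportional v u.
    move=> /asboolP[k k0 e]; apply/asboolP; exists k^-1; rewrite ?invr_eq0//.
    by rewrite e scalerA mulVf// scale1r.
  by move=> u v; apply/idP/idP; exact: sym.
- move=> v u w /asboolP[k k0 e] /asboolP[l l0 e']; apply/asboolP.
  by exists (k * l); rewrite ?mulf_neq0// e e' scalerA.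
Qed.

Canonical proportional_equiv_rel := EquivRelPack proportional_equiv.

(* The projective space of the linear subspace W, with the quotient
   topology. *)
Definition projectivization : topologicalType :=
  quotient_topology {eq_quot proportional_equiv_rel}.

(* Homogeneous coordinates: some representative of the class. *)
Definition homogeneous (p : projectivization) : 'M[C]_(m, n) :=
  set_val (repr (p : {eq_quot proportional_equiv_rel})).

End Projectivization.

Section Conics.
Variable R : realType.
Local Notation C := (complexes R).

Definition CP2 : topologicalType := projectivization [set: 'rV[C]_3].

(* The space CP^5 of conics. *)
Definition conic : topologicalType :=
  projectivization [set A : 'M[C]_3 | A^T = A].

Definition entry (A : 'M[C]_3) (i j : nat) : C := A (inord i) (inord j).

(* The coordinates of CP^5: a symmetric matrix is determined by its entries on
   and above the diagonal. *)
Definition sym_coords (A : 'M[C]_3) : 'rV[C]_6 :=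
  let a := entry A in
  \row_(k < 6) [:: a 0 0; a 0 1; a 0 2; a 1 1; a 1 2; a 2 2]%N`_k.

Definition conic_coords (c : conic) : 'rV[C]_6 := sym_coords (homogeneous c).

Definition affine_chart (k : 'I_6) : chart R conic 5 :=
  Chart [set c | conic_coords c 0 k != 0]
        (fun c => col' k ((conic_coords c 0 k)^-1 *: conic_coords c)).

Definition conic_atlas : set (chart R conic 5) := range affine_chart.

Definition nondegenerate (c : conic) : Prop := \det (homogeneous c) != 0.

Definition conic_points (c : conic) : set CP2 :=
  [set p | homogeneous p *m homogeneous c *m (homogeneous p)^T = 0].

Definition transverse_pairs : set (conic * conic) :=
  [set cd | [/\ nondegenerate cd.1, nondegenerate cd.2 &
     conic_points cd.1 `&` conic_points cd.2 #= `I_4]].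

Definition taylor_coef (f : C -> C) (k : nat) : C :=
  (f^`(k))%classic 0 / k`!%:R.

Definition sqrt_branch (f s : C -> C) : Prop :=
  \forall t \near (0 : C), derivable s t 1 /\ s t ^+ 2 = f t.

(* The pairs (C, D) for which sqrt (det (t C + D)) = A_0 + A_1 t + A_2 t^2 + ...
   has A_2 = 0.  This condition depends neither on the branch of the square
   root (the two branches near det D != 0 are opposite) nor on the
   representatives of the conics. *)
Definition cayley_set : set (conic * conic) :=
  [set cd | transverse_pairs cd /\
     exists s : C -> C,
       sqrt_branch
         (fun t => \det (t *: homogeneous cd.1 + homogeneous cd.2)) s /\
       taylor_coef s 2 = 0].

End Conics.

Arguments conic_atlas : clear implicits.
Arguments cayley_set : clear implicits.

(* Main.v *)
(* A pair (C, D) of non-degenerate conics is transverse iff C = g^T L g and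
   D = g^T g with L diagonal with distinct entries, iff the discriminant of
   det (t C + D) does not vanish: four common points in general position have
   a common self-polar triangle, and conversely a pencil with three distinct
   degenerate members is diagonalized by their singular points.  For such a pair
   the condition A_2 = 0 reads 4 e_2(L) = e_1(L)^2, which is Heron's equation and
   is solved by L = (p^2, q^2, (p + q)^2).

   Connectedness: the Cayley set is the image of the set of (g, p, q) where some
   non-zero polynomial does not vanish, and two points of the latter are joined
   by an arc inside a complex line.

   Smoothness: 4 s_03 s_21 - s_12^2 is a quadratic form in C, non-degenerate when
   D is.  Near a point of the Cayley set it has a non-zero partial derivative in
   some affine coordinate of C, in which it is a polynomial of degree 2, so that
   replacing this coordinate by the form is inverted by the quadratic formula,
   using a holomorphic square root near 1. *)
Require Import Defs.
From HB Require Import structures.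
From mathcomp Require Import all_boot all_order all_algebra generic_quotient.
From mathcomp Require Import complex.
From mathcomp Require Import all_classical all_reals all_analysis.
From mathcomp Require Import perm ring.

Set Implicit Arguments.
Unset Strict Implicit.
Unset Printing Implicit Defensive.

Import Order.TTheory GRing.Theory Num.Theory.
Import numFieldNormedType.Exports.

Local Open Scope classical_set_scope.
Local Open Scope card_scope.
Local Open Scope ring_scope.
Local Open Scope quotient_scope.

(** * Bilinear forms on the space of row vectors of length 3 *)

Section Forms.
Variable K : fieldType.
Implicit Types (A B Q : 'M[K]_3) (u v w : 'rV[K]_3).

(** A conic is reached only through an arbitrarily chosen matrix representative, and no such choice
    is continuous on CP^5. Both defining conditions are therefore turned into polynomial conditions
    on pairs of symmetric matrices, homogeneous in each matrix separately: the count of common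
    points becomes the non-vanishing of a discriminant, and A_2 = 0 becomes the vanishing of a form
    of bidegree (2, 4). Such conditions do not see the representative, are open or closed in any
    coordinates, and restrict to polynomials in one variable along a complex line.

    This is also what gives the dimension: the non-vanishing conditions persist near a point of the
    Cayley set, so that a single equation cuts it out locally in the 10-dimensional product CP^5 x
    CP^5. The simultaneous diagonalization is used a further time there, to see that some derivative
    of this equation is non-zero. The explicit inverse of the straightening map takes the place of
    an inverse function theorem. *)

Lemma det_mx33 A : let a i j := A (inord i) (inord j) in
  \det A = a 0 0 * (a 1 1 * a 2 2 - a 1 2 * a 2 1)
         - a 0 1 * (a 1 0 * a 2 2 - a 1 2 * a 2 0)
         + a 0 2 * (a 1 0 * a 2 1 - a 1 1 * a 2 0).
Proof.
move=> a; have aE (i j : 'I_3) : A i j = a i j by rewrite /a !inord_val.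
rewrite (expand_det_row _ ord0) !big_ord_recl big_ord0 /cofactor.
rewrite !(expand_det_row _ ord0) !big_ord_recl !big_ord0 /cofactor !det_mx11.
rewrite !mxE !aE /= /bump /=; ring.
Qed.

Definition bil A u v : K := (u *m A *m v^T) 0 0.

Lemma bilE A u v : u *m A *m v^T = (bil A u v)%:M.
Proof. by rewrite [LHS]mx11_scalar. Qed.

Lemma bilDl A u v w : bil A (u + v) w = bil A u w + bil A v w.
Proof. by rewrite /bil !mulmxDl mxE. Qed.

Lemma bilDr A u v w : bil A w (u + v) = bil A w u + bil A w v.
Proof. by rewrite /bil linearD mulmxDr mxE. Qed.

Lemma bilZl A k u v : bil A (k *: u) v = k * bil A u v.
Proof. by rewrite /bil -!scalemxAl mxE. Qed.

Lemma bilZr A k u v : bil A u (k *: v) = k * bil A u v.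
Proof. by rewrite /bil linearZ -scalemxAr mxE. Qed.

Lemma bilC A u v : A^T = A -> bil A u v = bil A v u.
Proof.
move=> sA; have -> : bil A u v = (v *m A *m u^T)^T 0 0; last by rewrite mxE.
by rewrite !trmx_mul trmxK sA mulmxA.
Qed.

Definition rows3 u v w : 'M[K]_3 := \matrix_(i < 3) [:: u; v; w]`_i.

Definition row3 (x y z : K) : 'rV[K]_3 := \row_i [:: x; y; z]`_i.

Definition diag3 x y z : 'M[K]_3 := diag_mx (row3 x y z).

Lemma ord3P (P : 'I_3 -> Prop) :
  P (inord 0) -> P (inord 1) -> P (inord 2) -> forall i, P i.
Proof.
by move=> P0 P1 P2 i; rewrite -(inord_val i); case: i => -[|[|[|]]].
Qed.

Lemma sum3 (V : nmodType) (F : 'I_3 -> V) :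
  \sum_i F i = F (inord 0) + F (inord 1) + F (inord 2).
Proof.
rewrite !big_ord_recl big_ord0 addr0 addrA.
by congr (F _ + F _ + F _); apply/val_inj; rewrite /= inordK.
Qed.

Lemma mul_rows3 a u v w :
  a *m rows3 u v w =
  a 0 (inord 0) *: u + a 0 (inord 1) *: v + a 0 (inord 2) *: w.
Proof. by rewrite mulmx_sum_row sum3 !rowK !inordK /=. Qed.

Lemma row3E x y z : [/\ row3 x y z 0 (inord 0) = x,
  row3 x y z 0 (inord 1) = y & row3 x y z 0 (inord 2) = z].
Proof. by rewrite !mxE !inordK. Qed.

Lemma row3_eta (a : 'rV[K]_3) : a =
  row3 (a 0 (inord 0)) (a 0 (inord 1)) (a 0 (inord 2)).
Proof. by apply/rowP; apply: ord3P; rewrite !mxE !inordK. Qed.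

Lemma rows3_form A u v w i j :
  (rows3 u v w *m A *m (rows3 u v w)^T) i j =
  bil A [:: u; v; w]`_i [:: u; v; w]`_j.
Proof.
transitivity ((row i (rows3 u v w *m A) *m (row j (rows3 u v w))^T) 0 0).
  by rewrite !mxE; apply: eq_bigr => k _; rewrite !mxE.
by rewrite row_mul !rowK.
Qed.

Lemma diag3E x y z i j :
  diag3 x y z i j = if i == j then [:: x; y; z]`_i else 0.
Proof. by rewrite !mxE; case: eqVneq => [->|]; rewrite ?mulr1n ?mulr0n. Qed.

Lemma det_diag3 x y z : \det (diag3 x y z) = x * y * z.
Proof. by rewrite det_diag !big_ord_recl big_ord0 !mxE /= mulr1 mulrA. Qed.

Lemma bil_diag3 x y z u : bil (diag3 x y z) u u =
  x * u 0 (inord 0) ^+ 2 + y * u 0 (inord 1) ^+ 2 + z * u 0 (inord 2) ^+ 2.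
Proof.
by rewrite /bil mul_mx_diag mxE sum3 !mxE !inordK //=; ring.
Qed.

Lemma bil_congr A Q u v : bil (Q^T *m A *m Q) u v = bil A (u *m Q^T) (v *m Q^T).
Proof. by rewrite /bil trmx_mul trmxK !mulmxA. Qed.

Lemma bil_mul A Q u v : bil A (u *m Q) (v *m Q) = bil (Q *m A *m Q^T) u v.
Proof. by rewrite /bil trmx_mul !mulmxA. Qed.

Lemma row_neq0P (u : 'rV[K]_3) : u != 0 ->
  u 0 (inord 0) != 0 \/ u 0 (inord 1) != 0 \/ u 0 (inord 2) != 0.
Proof.
move=> u0; have [e0|] := eqVneq (u 0 (inord 0)) 0; last by left.
have [e1|] := eqVneq (u 0 (inord 1)) 0; last by right; left.
have [e2|] := eqVneq (u 0 (inord 2)) 0; last by right; right.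
by case/negP: u0; apply/eqP/rowP; apply: ord3P; rewrite mxE.
Qed.

(** The scalar may be 0, so the relation is not symmetric in general; between non-zero vectors it is
    equality of projective points. *)
Definition proportionalv u v := exists k, u = k *: v.

(* Three pairwise distinct points of a non-degenerate conic are not collinear:
   otherwise the form would vanish on a plane, which is too large to be
   isotropic in dimension 3. *)
Lemma isotropic_rows3_unit A u v w : 2 != 0 :> K ->
  A^T = A -> A \in unitmx ->
  u != 0 -> v != 0 -> w != 0 ->
  ~ proportionalv u v -> ~ proportionalv u w -> ~ proportionalv v w ->
  ~ proportionalv v u -> ~ proportionalv w u -> ~ proportionalv w v ->
  bil A u u = 0 -> bil A v v = 0 -> bil A w w = 0 ->
  rows3 u v w \in unitmx.
Proof.
move=> K2 sA uA u0 v0 w0 uv uw vw vu wu wv Au Av Aw.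
rewrite unitmxE unitfE; apply/negP => /det0P[c c0].
rewrite mul_rows3; set c1 := c 0 _; set c2 := c 0 _; set c3 := c 0 _ => cE.
have two (x y : 'rV[K]_3) a b : ~ proportionalv x y -> y != 0 ->
    a *: x + b *: y = 0 -> a = 0 /\ b = 0.
  move=> xy y0 e; have [a0|a0] := eqVneq a 0.
    move: e; rewrite a0 scale0r add0r => /eqP.
    by rewrite scaler_eq0 (negPf y0) orbF => /eqP.
  exfalso; apply: xy; exists (- (a^-1 * b)).
  apply: (scalerI a0); rewrite scalerA mulrN mulrA mulfV// mul1r scaleNr.
  by apply/eqP; rewrite -addr_eq0 e.
have c3n0 : c3 != 0.
  apply/eqP => c30; move: cE; rewrite c30 scale0r addr0 => /(two _ _ _ _ uv v0)[e1 e2].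
  by case: (row_neq0P c0) => [|[]]; rewrite -/c1 -/c2 -/c3 ?e1 ?e2 ?c30 eqxx.
have wE : w = - (c3^-1 * c1) *: u + - (c3^-1 * c2) *: v.
  apply: (scalerI c3n0); rewrite scalerDr !scalerA !mulrN !mulrA mulfV// !mul1r.
  by apply/eqP; rewrite !scaleNr -opprD -addr_eq0 addrC cE.
set a := - _ in wE; set b := - _ in wE.
have a0 : a != 0 by apply/eqP => e; apply: wv; exists b; rewrite wE e scale0r add0r.
have b0 : b != 0 by apply/eqP => e; apply: wu; exists a; rewrite wE e scale0r addr0.
(* Expanding A(w, w) = 0 with w = a u + b v leaves 2 a b A(u, v), where a and b are non-zero. *)
have Auv : bil A u v = 0.
  move: Aw; rewrite wE !(bilDl, bilDr, bilZl, bilZr) Au Av (bilC v u sA).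
  rewrite !mulr0 addr0 add0r => /eqP.
  rewrite (_ : _ + _ = 2 * (a * b) * bil A u v); last by ring.
  by rewrite !mulf_eq0 (negPf a0) (negPf b0) (negPf K2) => /eqP.
pose N : 'M[K]_(2, 3) := \matrix_(i < 2) [:: u; v]`_i.
have NAN : N *m A *m N^T = 0.
  apply/matrixP => i j.
  transitivity ((row i (N *m A) *m (row j N)^T) 0 0).
    by rewrite !mxE; apply: eq_bigr => k _; rewrite !mxE.
  rewrite row_mul !rowK -/(bil A _ _) mxE.
  by case: i j => -[|[|//]] ? [[|[|//]] ?] /=; rewrite // bilC.
have rN : \rank N = 2.
  apply/eqP; change (row_free N); rewrite -kermx_eq0; apply/rowV0P => d /sub_kermxP.
  rewrite mulmx_sum_row !big_ord_recl big_ord0 addr0 !rowK /= =>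
    /(two _ _ _ _ uv v0)[e1 e2].
  apply/rowP => i; rewrite mxE.
  case: i => -[|[|//]] p; [rewrite -[RHS]e1|rewrite -[RHS]e2]; congr (d _ _);
    exact: val_inj.
(* Sylvester's inequality would give 2 + 2 <= 3. *)
have := mulmx0_rank_max NAN.
by rewrite mxrank_tr mxrankMfree ?rN// row_free_unit.
Qed.

Lemma det_neq0 A : (\det A != 0) = (A \in unitmx).
Proof. by rewrite unitmxE unitfE. Qed.

End Forms.

(** * Simultaneous diagonalization by congruence *)

Section Diagonalization.
Variable K : numClosedFieldType.
Implicit Types (A B Q g : 'M[K]_3) (u v w : 'rV[K]_3).

(** The numbers x, y, z are the eigenvalues of B^-1 A; the second form is normalized to the sum of
    three squares. *)
Definition simdiag A B g x y z :=
  [/\ g \in unitmx, A = g^T *m diag3 x y z *m g, B = g^T *m g &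
      [/\ x != y, y != z & x != z]].

(** Scaling the diagonalizing basis by square roots of the diagonal entries of B turns B into the
    identity and divides the entries of A by those of B. *)
Lemma simdiag_of_diag A B Q a b c a' b' c' : Q \in unitmx ->
  Q *m A *m Q^T = diag3 a b c -> Q *m B *m Q^T = diag3 a' b' c' ->
  a' != 0 -> b' != 0 -> c' != 0 ->
  a / a' != b / b' -> b / b' != c / c' -> a / a' != c / c' ->
  exists g, simdiag A B g (a / a') (b / b') (c / c').
Proof.
move=> uQ QA QB a0 b0 c0 ab bc ac.
pose s := diag3 (sqrtC a') (sqrtC b') (sqrtC c').
have [T uT TQ] : exists2 T : 'M[K]_3, T \in unitmx & T *m Q = 1%:M.
  by exists (invmx Q); rewrite ?unitmx_inv ?mulVmx.
have TE M N : Q *m M *m Q^T = N -> M = T *m N *m T^T.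
  move=> <-; rewrite !mulmxA TQ mul1mx -mulmxA -trmx_mul TQ trmx1 mulmx1//.
have sT : s^T = s by rewrite tr_diag_mx.
exists (s *m T^T); split => //.
- rewrite unitmx_mul unitmx_tr uT andbT unitmxE det_diag3 unitfE.
  by rewrite !mulf_neq0// sqrtC_eq0.
- rewrite (TE _ _ QA) trmx_mul trmxK sT !mulmxA; congr (_ *m _).
  rewrite -!mulmxA; congr (_ *m _).
  rewrite !mulmx_diag; congr diag_mx; apply/rowP; apply: ord3P;
   by rewrite !mxE !inordK //= mulrCA -expr2 sqrtCK divfK.
- rewrite (TE _ _ QB) trmx_mul trmxK sT !mulmxA; congr (_ *m _).
  rewrite -!mulmxA; congr (_ *m _).
  rewrite !mulmx_diag; congr diag_mx; apply/rowP; apply: ord3P;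
   by rewrite !mxE !inordK //= -expr2 sqrtCK.
Qed.

End Diagonalization.

(** * Transversality and the common self-polar triangle *)

Section FourPoints.
Variable K : numClosedFieldType.
Implicit Types (A B Q g : 'M[K]_3) (u v w : 'rV[K]_3).

(** The base locus of the pencil, in homogeneous coordinates: four distinct points, and no other. *)
Definition four_points A B (p : 'I_4 -> 'rV[K]_3) :=
  [/\ forall i, p i != 0,
      forall i j, proportionalv (p i) (p j) -> i = j,
      forall i, bil A (p i) (p i) = 0 /\ bil B (p i) (p i) = 0 &
      forall u, u != 0 -> bil A u u = 0 -> bil B u u = 0 ->
        exists i, proportionalv u (p i)].

(** In diagonal coordinates the squares (a^2, b^2, c^2) of a common zero are orthogonal to (1, 1, 1)
    and (x, y, z), hence proportional to their cross product (y - z, z - x, x - y). Its entries are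
    non-zero, and the choices of signs up to a global one give four points. *)
Lemma simdiag_four_points A B g x y z : simdiag A B g x y z ->
  exists p, four_points A B p.
Proof.
case=> ug -> -> [xy yz xz].
pose r := sqrtC (y - z); pose s := sqrtC (z - x); pose t := sqrtC (x - y).
have [r0 s0 t0] : [/\ r != 0, s != 0 & t != 0].
  by rewrite !sqrtC_eq0 !subr_eq0 (eq_sym z).
have [rE sE tE] : [/\ r ^+ 2 = y - z, s ^+ 2 = z - x & t ^+ 2 = x - y].
  by rewrite !sqrtCK.
have two0 : 2 != 0 :> K by rewrite pnatr_eq0.
have uh : invmx g^T \in unitmx by rewrite unitmx_inv unitmx_tr.
have hK : invmx g^T *m g^T = 1%:M by rewrite mulVmx ?unitmx_tr.
have gg : g^T *m g = g^T *m diag3 1 1 1 *m g.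
  rewrite (_ : diag3 1 1 1 = 1%:M) ?mulmx1//; apply/matrixP => i j.
  by rewrite diag3E mxE; case: eqVneq => // _; move: i; apply: ord3P; rewrite inordK.
(* The two bits of i are the signs of the last two coordinates; the first one is kept equal to r to
   fix the global sign. *)
pose q (i : nat) := row3 r ((-1) ^+ odd i * s) ((-1) ^+ odd i./2 * t).
have bilq M i : bil (g^T *m M *m g) (q i *m invmx g^T) (q i *m invmx g^T)
    = bil M (q i) (q i).
  by rewrite bil_congr -!mulmxA hK mulmx1.
have sgn2 (b : bool) (m : K) : ((-1) ^+ b * m) ^+ 2 = m ^+ 2.
  by rewrite exprMn -exprM mulnC exprM sqrrN !expr1n mul1r.
exists (fun i => q i *m invmx g^T); split.
- move=> i; apply/eqP => /(congr1 (mulmx^~ g^T)).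
  rewrite -mulmxA hK mulmx1 mul0mx => /rowP/(_ (inord 0)).
  by have [-> _ _] := row3E r ((-1) ^+ odd i * s) ((-1) ^+ odd i./2 * t);
    rewrite mxE => /eqP; rewrite (negPf r0).
- move=> i j [k] /(congr1 (mulmx^~ g^T)).
  rewrite -scalemxAl -!mulmxA hK !mulmx1 => /rowP e.
  move: (e (inord 0)) (e (inord 1)) (e (inord 2)); rewrite !mxE !inordK //=.
  move=> e0; have -> : k = 1 by apply: (mulIf r0); rewrite mul1r.
  rewrite !mul1r => /(mulIf s0)/signr_inj e1 /(mulIf t0)/signr_inj e2.
  apply/val_inj => /=.
  by case: i j e1 e2 {e} => -[|[|[|[|//]]]] ? [[|[|[|[|//]]]] ?].
- move=> i; rewrite bilq gg bilq.
  rewrite !bil_diag3 !mxE !inordK //= !sgn2 rE sE tE; split; ring.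
- move=> u u0; set v := u *m g^T.
  have vE : u = v *m invmx g^T by rewrite -mulmxA mulmxV ?unitmx_tr// mulmx1.
  rewrite gg !bil_congr -/v.
  rewrite !bil_diag3 !mul1r.
  set a := v 0 _; set b := v 0 _; set c := v 0 _ => e1 e2.
  have e3 : (a * s) ^+ 2 = (b * r) ^+ 2.
    rewrite !exprMn sE rE.
    transitivity (b ^+ 2 * (y - z) + (z * (a ^+ 2 + b ^+ 2 + c ^+ 2) -
       (x * a ^+ 2 + y * b ^+ 2 + z * c ^+ 2))); first by ring.
    by rewrite e1 e2; ring.
  have e4 : (a * t) ^+ 2 = (c * r) ^+ 2.
    rewrite !exprMn tE rE.
    transitivity (c ^+ 2 * (y - z) - (y * (a ^+ 2 + b ^+ 2 + c ^+ 2) -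
       (x * a ^+ 2 + y * b ^+ 2 + z * c ^+ 2))); first by ring.
    by rewrite e1 e2; ring.
  have sgn (m n : K) : m ^+ 2 = n ^+ 2 -> exists b : bool, n = (-1) ^+ b * m.
    move=> /eqP; rewrite eqf_sqr => /orP[]/eqP ->; first by exists false; rewrite mul1r.
    by exists true; rewrite mulN1r opprK.
  have [b1 eb] := sgn _ _ e3; have [b2 ec] := sgn _ _ e4.
  have lt4 : (b1 + b2.*2 < 4)%N by case: b1 b2 {eb ec} => -[].
  exists (Ordinal lt4), (a / r); rewrite {1}vE scalemxAl; congr (_ *m _).
  rewrite (row3_eta v) -/a -/b -/c /q /=.
  have -> : odd (b1 + b2.*2) = b1 by rewrite oddD odd_double addbF; case: (b1).
  have -> : odd (b1 + b2.*2)./2 = b2 by rewrite half_bit_double; case: (b2).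
  by apply/rowP; apply: ord3P; rewrite !mxE !inordK //=;
    apply: (mulIf r0); rewrite ?eb ?ec; field.
Qed.

(** The triangle is the diagonal triangle of the quadrangle of base points. With representatives
    such that the fourth point is u + v + w, its vertices are u + v, u + w, v + w, and they are
    pairwise orthogonal for every form M vanishing at the four points, because M(u, v) + M(u, w) +
    M(v, w) = 0. *)
Lemma four_points_simdiag A B p : A^T = A -> B^T = B ->
  A \in unitmx -> B \in unitmx -> four_points A B p ->
  exists g x y z, simdiag A B g x y z.
Proof.
move=> sA sB uA uB [p0 pinj pAB pall].
have two0 : 2 != 0 :> K by rewrite pnatr_eq0.
pose o (k : nat) : 'I_4 := inord k.
have oN (a b : nat) : (a < 4)%N -> (b < 4)%N -> a != b ->
  ~ proportionalv (p (o a)) (p (o b)).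
  move=> a4 b4 ab /pinj/(congr1 val); rewrite /= !inordK // => e.
  by rewrite e eqxx in ab.
have R3 a b c : (a < 4)%N -> (b < 4)%N -> (c < 4)%N -> a != b -> a != c -> b != c ->
    rows3 (p (o a)) (p (o b)) (p (o c)) \in unitmx.
  move=> a4 b4 c4 ab ac bc.
  have [Aa _] := pAB (o a); have [Ab _] := pAB (o b); have [Ac _] := pAB (o c).
  have [ba ca cb] : [/\ b != a, c != a & c != b] by rewrite !(eq_sym c) (eq_sym b).
  exact: (isotropic_rows3_unit two0 sA uA (p0 _) (p0 _) (p0 _) (oN _ _ a4 b4 ab)
    (oN _ _ a4 c4 ac) (oN _ _ b4 c4 bc) (oN _ _ b4 a4 ba) (oN _ _ c4 a4 ca)
    (oN _ _ c4 b4 cb)).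
pose P := rows3 (p (o 0)) (p (o 1)) (p (o 2)).
have uP : P \in unitmx by exact: R3.
pose d := p (o 3) *m invmx P.
have p3E : p (o 3) = d *m P by rewrite -mulmxA mulVmx// mulmx1.
move: (p3E); rewrite mul_rows3.
set d0 := d 0 _; set d1 := d 0 _; set d2 := d 0 _ => {}p3E.
have dep u v w : rows3 u v w \in unitmx -> forall c : 'rV_3,
   c 0 (inord 0) *: u + c 0 (inord 1) *: v + c 0 (inord 2) *: w = 0 -> c = 0.
  move=> uM c; rewrite -mul_rows3 => /(congr1 (mulmx^~ (invmx (rows3 u v w)))).
  by rewrite -mulmxA mulmxV// mulmx1 mul0mx.
have dep3 u v w : rows3 u v w \in unitmx -> forall a b : K, w != a *: u + b *: v.
  move=> uM a b; apply/eqP => e.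
  have := dep _ _ _ uM (row3 a b (-1)); have [-> -> ->] := row3E a b (-1).
  rewrite scaleN1r e subrr => /(_ erefl)/rowP/(_ (inord 2)).
  by have [_ _ ->] := row3E a b (-1); rewrite mxE => /eqP; rewrite oppr_eq0 oner_eq0.
(* A zero coordinate of the fourth point would make three of the four points collinear. *)
have d0n : d0 != 0.
  apply/eqP => e; have := dep3 _ _ _ (R3 1 2 3 isT isT isT isT isT isT)%N d1 d2.
  by rewrite {1}p3E e scale0r add0r eqxx.
have d1n : d1 != 0.
  apply/eqP => e; have := dep3 _ _ _ (R3 0 2 3 isT isT isT isT isT isT)%N d0 d2.
  by rewrite {1}p3E e scale0r addr0 eqxx.
have d2n : d2 != 0.
  apply/eqP => e; have := dep3 _ _ _ (R3 0 1 3 isT isT isT isT isT isT)%N d0 d1.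
  by rewrite {1}p3E e scale0r addr0 eqxx.
pose u := d0 *: p (o 0); pose v := d1 *: p (o 1); pose w := d2 *: p (o 2).
have uvw : p (o 3) = u + v + w by [].
have iso M : M^T = M -> (forall i, bil M (p i) (p i) = 0) ->
  [/\ bil M u u = 0, bil M v v = 0, bil M w w = 0 &
     bil M u v + bil M u w + bil M v w = 0].
  move=> sM Mp; have [e0 e1 e2] : [/\ bil M u u = 0, bil M v v = 0 & bil M w w = 0].
    by rewrite !bilZl !bilZr !Mp !mulr0.
  split=> //; have := Mp (o 3); rewrite uvw !bilDl !bilDr e0 e1 e2.
  rewrite (bilC v u)// (bilC w u)// (bilC w v)//.
  rewrite (_ : _ + _ = 2 * (bil M u v + bil M u w + bil M v w)); last by ring.
  by move=> /eqP; rewrite mulf_eq0 (negPf two0) => /eqP.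
pose Q := rows3 (u + v) (u + w) (v + w).
(* No base point lies on the side through the first two diagonal points. This will contradict the
   existence of a common zero there if A and B were proportional. *)
have uvwE (i : 'I_4) : exists2 y : 'rV[K]_3, 2 *: p i = y *m Q & y 0 (inord 2) != 0.
  have H k (a b c : K) j : k != 0 -> c != 0 -> 2 *: (k *: p j) = row3 a b c *m Q ->
      exists2 y : 'rV[K]_3, 2 *: p j = y *m Q & y 0 (inord 2) != 0.
    move=> k0 c0 e; exists (k^-1 *: row3 a b c).
      by rewrite -scalemxAl -e !scalerA mulrAC mulVf// mul1r.
    by rewrite mxE; have [_ _ ->] := row3E a b c; rewrite mulf_neq0// invr_eq0.
  have E a b c : row3 a b c *m Q = (a + b) *: u + (a + c) *: v + (b + c) *: w.
    rewrite mul_rows3; have [-> -> ->] := row3E a b c.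
    by apply/rowP => m; rewrite !mxE; ring.
  have N1 : -1 != 0 :> K by rewrite oppr_eq0 oner_eq0.
  rewrite -(inord_val i); case: i => -[|[|[|[|//]]]] /= _.
  - apply: (H d0 1 1 (-1)) => //.
    by rewrite E subrr !scale0r !addr0.
  - apply: (H d1 1 (-1) 1); rewrite ?oner_neq0 //.
    by rewrite E subrr addNr !scale0r addr0 add0r.
  - apply: (H d2 (-1) 1 1); rewrite ?oner_neq0 //.
    by rewrite E addNr !scale0r !add0r.
  - apply: (H 1 1 1 1); rewrite ?oner_neq0 //.
    by rewrite E -!scalerDr -uvw scale1r.
have QE M : M^T = M -> (forall i, bil M (p i) (p i) = 0) ->
    Q *m M *m Q^T = diag3 (2 * bil M u v) (2 * bil M u w) (2 * bil M v w).
  move=> sM /(iso _ sM)[e0 e1 e2 e3].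
  apply/matrixP => i j; rewrite rows3_form diag3E.
  move: i j; apply: ord3P; apply: ord3P;
    rewrite /eq_op /= !inordK //= !bilDl !bilDr ?e0 ?e1 ?e2
    ?(bilC v u)// ?(bilC w u)// ?(bilC w v)//; first [ring | rewrite -[RHS]e3; ring].
have QA := QE _ sA (fun i => proj1 (pAB i)).
have QB := QE _ sB (fun i => proj2 (pAB i)).
have [_ _ _ eA] := iso _ sA (fun i => proj1 (pAB i)).
have [_ _ _ eB] := iso _ sB (fun i => proj2 (pAB i)).
have uQ : Q \in unitmx.
  have -> : Q = rows3 (row3 1 1 0) (row3 1 0 1) (row3 0 1 1) *m
                diag3 d0 d1 d2 *m P.
    have rowE a b c : row3 a b c *m (diag3 d0 d1 d2 *m P) = a *: u + b *: v + c *: w.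
      rewrite mulmxA mul_rows3;
        have -> : row3 a b c *m diag3 d0 d1 d2 = row3 (a * d0) (b * d1) (c * d2).
        apply/rowP => j; rewrite mxE (bigD1 j) //= big1 ?addr0.
          by rewrite diag3E eqxx; move: j; apply: ord3P; rewrite !mxE !inordK.
        by move=> k kj; rewrite diag3E (negPf kj) mulr0.
      by have [-> -> ->] := row3E (a * d0) (b * d1) (c * d2); rewrite -!scalerA.
    rewrite -mulmxA; apply/row_matrixP; apply: ord3P;
      rewrite row_mul !rowK !inordK //= rowE;
     by rewrite !scale1r ?scale0r ?addr0 ?add0r.
  rewrite !unitmx_mul uP andbT !unitmxE det_diag3 !unitfE !mulf_neq0// andbT.
  have -> : \det (rows3 (row3 1 1 0) (row3 1 0 1) (row3 0 1 1)) = -2 :> K.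
    by rewrite det_mx33 !mxE !inordK //= !mxE !inordK //=; ring.
  by rewrite oppr_eq0.
move: QA QB eA eB; set a := bil A u v; set b := bil A u w; set c := bil A v w.
set a' := bil B u v; set b' := bil B u w; set c' := bil B v w => QA QB eA eB.
have n0 M x y z : M \in unitmx -> Q *m M *m Q^T = diag3 (2 * x) (2 * y) (2 * z) ->
    [/\ x != 0, y != 0 & z != 0].
  move=> uM /(congr1 determinant); rewrite det_diag3 => e.
  have : 2 * x * (2 * y) * (2 * z) != 0.
    by rewrite -e -unitfE -unitmxE !unitmx_mul uQ uM unitmx_tr uQ.
  by rewrite !mulf_eq0 !negb_or => /andP[/andP[/andP[_ ?] /andP[_ ?]] /andP[_ ?]].
have [a0 b0 c0] := n0 _ _ _ _ uA QA; have [a0' b0' c0'] := n0 _ _ _ _ uB QB.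
have cE : c = - (a + b) by apply/eqP; rewrite -addr_eq0 addrC eA.
have cE' : c' = - (a' + b') by apply/eqP; rewrite -addr_eq0 addrC eB.
(* Otherwise A and B are proportional, and their common points include one on
   the line through the first two of the diagonal points. *)
have ab : a * b' != b * a'.
  apply/eqP => e; pose y := row3 (sqrtC (- (b / a))) 1 0.
  have By M x1 x2 x3 : Q *m M *m Q^T = diag3 (2 * x1) (2 * x2) (2 * x3) ->
      bil M (y *m Q) (y *m Q) = 2 * (x2 - x1 * (b / a)).
    rewrite bil_mul => ->; rewrite bil_diag3.
    have [-> -> ->] := row3E (sqrtC (- (b / a))) 1 0.
    by rewrite sqrtCK expr1n expr0n /=; ring.
  have yQ0 : y *m Q != 0.
    apply/eqP => /(congr1 (mulmx^~ (invmx Q))).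
    rewrite -mulmxA mulmxV// mulmx1 mul0mx => /rowP/(_ (inord 1)).
    have [_ -> _] := row3E (sqrtC (- (b / a))) 1 0.
    by rewrite mxE => /eqP; rewrite oner_eq0.
  have [||i [k yE]] := pall _ yQ0.
  - by rewrite (By _ _ _ _ QA) (mulrC a) divfK// subrr mulr0.
  - rewrite (By _ _ _ _ QB) (_ : b' - _ = 0) ?mulr0//.
    by apply: (mulfI a0); rewrite mulrBr e; field.
  have [x xE x2] := uvwE i.
  have : y *m Q = (k / 2) *: x *m Q.
    by rewrite yE -scalemxAl -xE scalerA divfK.
  move=> /(congr1 (mulmx^~ (invmx Q))); rewrite -!mulmxA mulmxV// !mulmx1.
  move=> /[dup] /rowP/(_ (inord 2)) + /rowP/(_ (inord 1)).
  have [_ -> ->] := row3E (sqrtC (- (b / a))) 1 0; rewrite !mxE.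
  move=> /esym/eqP; rewrite mulf_eq0 (negPf x2) orbF => /eqP ->.
  by rewrite mul0r => /eqP; rewrite oner_eq0.
have [||||||g Hg] := simdiag_of_diag uQ QA QB; rewrite ?mulf_neq0//; last first.
- by exists g, (2 * a / (2 * a')), (2 * b / (2 * b')), (2 * c / (2 * c')).
(* Since c = - (a + b) and c' = - (a' + b'), equality of any two of the ratios a / a', b / b', c /
   c' forces a b' = b a'. *)
all: rewrite eqr_div ?mulf_neq0//; apply: contra ab => /eqP e; apply/eqP;
  apply: (mulfI two0); apply: (mulfI two0).
- move: e; rewrite cE cE'; set X := _ * (2 * - _); set Y := _ * (2 * a') => e.
  transitivity (2 * (2 * (b * a')) - (X - Y)); first by rewrite /X /Y; ring.
  by rewrite e subrr subr0.
- move: e; rewrite cE cE'; set X := _ * (2 * - _); set Y := _ * (2 * b') => e.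
  transitivity (2 * (2 * (b * a')) + (X - Y)); first by rewrite /X /Y; ring.
  by rewrite e subrr addr0.
- by transitivity (2 * a * (2 * b')); [ring|rewrite e; ring].
Qed.
End FourPoints.

(** * Invariants of a pencil of conics *)

Section Pencils.
Variable K : numClosedFieldType.
Implicit Types (A B Q g : 'M[K]_3) (u v w : 'rV[K]_3).

(** The middle coefficients of the cubic det (t A + B), read off from the even and odd parts of its
    values at t = 1 and t = -1. *)
Definition sigma21 A B := (\det (A + B) + \det (B - A)) / 2 - \det B.
Definition sigma12 A B := (\det (A + B) - \det (B - A)) / 2 - \det A.

(** Proportional to A_2, with a non-zero factor when det B is non-zero. It is quadratic in A, which
    drives the whole study of smoothness. *)
Definition cayley_form A B := 4 * \det B * sigma21 A B - sigma12 A B ^+ 2.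

Definition cubic_disc (a b c d : K) :=
  b ^+ 2 * c ^+ 2 - 4 * a * c ^+ 3 - 4 * b ^+ 3 * d - 27 * a ^+ 2 * d ^+ 2
  + 18 * a * b * c * d.

(** Expresses transversality as an open polynomial condition, which the cardinality of the
    intersection does not show. *)
Definition pencil_disc A B :=
  cubic_disc (\det A) (sigma21 A B) (sigma12 A B) (\det B).

Lemma det_pencil A B k l : \det (k *: A + l *: B) =
  \det A * k ^+ 3 + sigma21 A B * k ^+ 2 * l + sigma12 A B * k * l ^+ 2
  + \det B * l ^+ 3.
Proof.
have two0 : 2 != 0 :> K by rewrite pnatr_eq0.
rewrite /sigma21 /sigma12 !det_mx33 !mxE.
set a00 := A _ _; set a01 := A _ _; set a02 := A _ _.
set a10 := A _ _; set a11 := A _ _; set a12 := A _ _.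
set a20 := A _ _; set a21 := A _ _; set a22 := A _ _.
by field.
Qed.

Lemma sigmaZ A B k l :
  sigma21 (k *: A) (l *: B) = k ^+ 2 * l * sigma21 A B /\
  sigma12 (k *: A) (l *: B) = k * l ^+ 2 * sigma12 A B.
Proof.
have two0 : 2 != 0 :> K by rewrite pnatr_eq0.
rewrite {1}/sigma21 {1}/sigma12 (addrC (l *: B) (- _)) -scaleNr !det_pencil !detZ.
by split; field.
Qed.

Lemma cayley_formZ A B k l :
  cayley_form (k *: A) (l *: B) = k ^+ 2 * l ^+ 4 * cayley_form A B.
Proof. by rewrite /cayley_form; have [-> ->] := sigmaZ A B k l; rewrite detZ; ring. Qed.

Lemma pencil_discZ A B k l :
  pencil_disc (k *: A) (l *: B) = k ^+ 6 * l ^+ 6 * pencil_disc A B.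
Proof.
by rewrite /pencil_disc /cubic_disc; have [-> ->] := sigmaZ A B k l; rewrite !detZ;
  ring.
Qed.

Lemma sigma_congr A B g :
  sigma21 (g^T *m A *m g) (g^T *m B *m g) = \det g ^+ 2 * sigma21 A B /\
  sigma12 (g^T *m A *m g) (g^T *m B *m g) = \det g ^+ 2 * sigma12 A B.
Proof.
have two0 : 2 != 0 :> K by rewrite pnatr_eq0.
rewrite /sigma21 /sigma12 -mulmxDl -mulmxBl -mulmxDr -mulmxBr !det_mulmx det_tr.
by split; field.
Qed.

Lemma cayley_form_congr A B g :
  cayley_form (g^T *m A *m g) (g^T *m B *m g) = \det g ^+ 4 * cayley_form A B.
Proof.
rewrite /cayley_form; have [-> ->] := sigma_congr A B g.
by rewrite !det_mulmx det_tr; ring.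
Qed.

Lemma sigma_diag x y z :
  sigma21 (diag3 x y z) 1%:M = x * y + y * z + x * z /\
  sigma12 (diag3 x y z) 1%:M = x + y + z.
Proof.
have two0 : 2 != 0 :> K by rewrite pnatr_eq0.
by rewrite /sigma21 /sigma12 !det_mx33 !mxE /eq_op /= !inordK //=; split; field.
Qed.

Lemma pencil_disc_diag g x y z :
  pencil_disc (g^T *m diag3 x y z *m g) (g^T *m g) =
  \det g ^+ 8 * ((x - y) * (y - z) * (x - z)) ^+ 2.
Proof.
rewrite -{2}(mulmx1 g^T) /pencil_disc /cubic_disc.
have [-> ->] := sigma_congr (diag3 x y z) 1%:M g; have [-> ->] := sigma_diag x y z.
by rewrite !det_mulmx det_tr det1 det_diag3; ring.
Qed.

Lemma cayley_form_diag g x y z :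
  cayley_form (g^T *m diag3 x y z *m g) (g^T *m g) =
  \det g ^+ 4 * (4 * (x * y + y * z + x * z) - (x + y + z) ^+ 2).
Proof.
rewrite -{2}(mulmx1 g^T) cayley_form_congr /cayley_form.
by have [-> ->] := sigma_diag x y z; rewrite det1; ring.
Qed.

(* Heron's formula: the left-hand side is sixteen times the squared area of
   the triangle whose sides have squares x, y, z. *)
Lemma heron_param (x y z : K) :
  4 * (x * y + y * z + x * z) - (x + y + z) ^+ 2 = 0 ->
  exists p q, [/\ x = p ^+ 2, y = q ^+ 2 & z = (p + q) ^+ 2].
Proof.
set p := sqrtC x; set q := sqrtC y.
have [<- <-] : p ^+ 2 = x /\ q ^+ 2 = y by rewrite !sqrtCK.
move=> e; have : (z - p ^+ 2 - q ^+ 2) ^+ 2 = (2 * (p * q)) ^+ 2.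
  by apply/eqP; rewrite -subr_eq0 -oppr_eq0 -e; apply/eqP; ring.
(* The equation says z - p^2 - q^2 = 2 p q up to sign, and the sign is absorbed by the choice of the
   square root q. *)
move=> /eqP; rewrite eqf_sqr => /orP[] /eqP E.
  exists p, q; split => //; transitivity (z - p ^+ 2 - q ^+ 2 + p ^+ 2 + q ^+ 2).
    by ring.
  by rewrite E; ring.
exists p, (- q); rewrite sqrrN; split => //.
transitivity (z - p ^+ 2 - q ^+ 2 + p ^+ 2 + q ^+ 2); first by ring.
by rewrite E; ring.
Qed.

(** For kernel vectors v of t A + B and w of s A + B, symmetry gives - t A(v, w) = B(v, w) = - s
    A(v, w), so distinct roots yield vectors orthogonal for both forms. *)
Lemma simdiag_of_disc A B : A^T = A -> B^T = B -> A \in unitmx -> B \in unitmx ->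
  pencil_disc A B != 0 -> exists g x y z, simdiag A B g x y z.
Proof.
move=> sA sB uA uB d0.
pose P : {poly K} := (\det A)%:P * 'X^3 + (sigma21 A B)%:P * 'X^2
  + (sigma12 A B)%:P * 'X + (\det B)%:P.
have PE t : P.[t] = \det (t *: A + B).
  by rewrite -[B in RHS]scale1r det_pencil /P !(hornerD, hornerCM, hornerXn,
    hornerX, hornerC); ring.
have detA : \det A != 0 by rewrite -unitfE -unitmxE.
have detB : \det B != 0 by rewrite -unitfE -unitmxE.
have Pi i : P`_i = [:: \det B; sigma12 A B; sigma21 A B; \det A]`_i.
  rewrite /P !coefD !coefCM !coefXn coefX coefC.
  by case: i => [|[|[|[|i]]]] /=; rewrite ?nth_nil ?mulr0n ?mulr1n; ring.
have sP : size P = 4%N.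
  apply/eqP; rewrite eqn_leq; apply/andP; split.
    by apply/leq_sizeP => -[|[|[|[|i]]]] // _; rewrite Pi /= nth_nil.
  by rewrite ltnNge; apply/negP => /leq_sizeP/(_ 3 isT)/eqP; rewrite Pi (negPf detA).
have [r rE] := closed_field_poly_normal P.
have lP : lead_coef P = \det A by rewrite /lead_coef sP Pi.
have : size r = 3%N.
  apply: succn_inj; rewrite -sP rE size_scale ?size_prod_XsubC//.
  by rewrite lP.
case: r rE => [|r1 [|r2 [|r3 []]]] // + _; rewrite lP !big_cons big_nil mulr1 => rE.
have [e1 e2 e3] : [/\ sigma21 A B = - \det A * (r1 + r2 + r3),
    sigma12 A B = \det A * (r1 * r2 + r2 * r3 + r1 * r3) &
    \det B = - \det A * (r1 * r2 * r3)].
  have RE : P = (\det A)%:P * 'X^3 + (- \det A * (r1 + r2 + r3))%:P * 'X^2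
      + (\det A * (r1 * r2 + r2 * r3 + r1 * r3))%:P * 'X
      + (- \det A * (r1 * r2 * r3))%:P.
    by rewrite rE -mul_polyC !rmorphM !rmorphD !rmorphN !rmorphM /=; ring.
  have C i : P`_i = [:: - \det A * (r1 * r2 * r3);
      \det A * (r1 * r2 + r2 * r3 + r1 * r3); - \det A * (r1 + r2 + r3); \det A]`_i.
    rewrite RE !coefD !coefCM !coefXn coefX coefC.
    by case: i => [|[|[|[|i]]]] /=; rewrite ?nth_nil ?mulr0n ?mulr1n; ring.
  by split; [have := C 2%N|have := C 1%N|have := C 0%N]; rewrite Pi.
move: d0; rewrite /pencil_disc e1 e2 e3.
have -> : cubic_disc (\det A) (- \det A * (r1 + r2 + r3))
    (\det A * (r1 * r2 + r2 * r3 + r1 * r3)) (- \det A * (r1 * r2 * r3)) =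
    \det A ^+ 4 * ((r1 - r2) * (r2 - r3) * (r1 - r3)) ^+ 2.
  by rewrite /cubic_disc; ring.
rewrite mulf_eq0 expf_eq0 (negPf detA) /= expf_eq0 /= !mulf_eq0 !negb_or !subr_eq0.
move=> /andP[/andP[r12 r23] r13].
have [r10 r20 r30] : [/\ r1 != 0, r2 != 0 & r3 != 0].
  by move: detB; rewrite e3 !mulf_eq0 !negb_or => /andP[_ /andP[/andP[? ?] ?]].
have eig t : (t == r1) || (t == r2) || (t == r3) ->
    exists2 v : 'rV_3, v != 0 & v *m (t *: A + B) = 0.
  move=> tr; apply/det0P; rewrite -PE rE hornerZ !hornerM !hornerXsubC.
  by case/orP: tr => [/orP[]|] /eqP ->; rewrite subrr ?mul0r ?mulr0 ?mul0r ?mulr0.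
have [|v1 v10 E1] := eig r1; first by rewrite eqxx.
have [|v2 v20 E2] := eig r2; first by rewrite eqxx orbT.
have [|v3 v30 E3] := eig r3; first by rewrite eqxx !orbT.
have vB t (v : 'rV_3) : v *m (t *: A + B) = 0 -> v *m B = - t *: (v *m A).
  by rewrite mulmxDr -scalemxAr => /eqP; rewrite addrC addr_eq0 scaleNr => /eqP.
have bB t v w : v *m (t *: A + B) = 0 -> bil B v w = - t * bil A v w.
  by move=> /vB e; rewrite /bil e -scalemxAl mxE.
have orth t s v w : t != s -> v *m (t *: A + B) = 0 -> w *m (s *: A + B) = 0 ->
    bil A v w = 0 /\ bil B v w = 0.
  move=> ts /bB ev /bB ew; suff e : bil A v w = 0 by rewrite ev e mulr0.
  have : - t * bil A v w = - s * bil A v w by rewrite -ev (bilC v)// ew (bilC w).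
  move=> /eqP; rewrite !mulNr eqr_opp -subr_eq0 -mulrBl mulf_eq0 subr_eq0 (negPf ts).
  by move=> /eqP.
pose V := rows3 v1 v2 v3.
(* Independence of eigenvectors with distinct eigenvalues: a linear relation u1 + u2 + u3 = 0 is
   transformed twice by B A^-1, which multiplies the i-th term by - ri each time, and a Lagrange
   combination of the three relations isolates one term. *)
have uV : V \in unitmx.
  rewrite unitmxE unitfE; apply/negP => /det0P[c c0]; rewrite mul_rows3.
  set u1 := _ *: v1; set u2 := _ *: v2; set u3 := _ *: v3 => S0.
  have shift (w1 w2 w3 : 'rV_3) : w1 *m (r1 *: A + B) = 0 -> w2 *m (r2 *: A + B) = 0 ->
     w3 *m (r3 *: A + B) = 0 -> w1 + w2 + w3 = 0 -> r1 *: w1 + r2 *: w2 + r3 *: w3 = 0.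
    move=> /vB F1 /vB F2 /vB F3 S.
    apply: (can_inj (mulmxK uA)); rewrite mul0mx !mulmxDl -!scalemxAl.
    apply/eqP; rewrite -oppr_eq0 !opprD -!scaleNr -F1 -F2 -F3 -!mulmxDl S.
    by rewrite mul0mx.
  have Z k t (v : 'rV_3) : v *m (t *: A + B) = 0 -> (k *: v) *m (t *: A + B) = 0.
    by rewrite -scalemxAl => ->; rewrite scaler0.
  have S1 := shift _ _ _ (Z _ _ _ E1) (Z _ _ _ E2) (Z _ _ _ E3) S0.
  have S2 := shift _ _ _ (Z _ _ _ (Z _ _ _ E1)) (Z _ _ _ (Z _ _ _ E2))
    (Z _ _ _ (Z _ _ _ E3)) S1.
  have U (a b d : K) (w1 w2 w3 : 'rV_3) : w1 + w2 + w3 = 0 ->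
     a *: w1 + b *: w2 + d *: w3 = 0 ->
     a *: (a *: w1) + b *: (b *: w2) + d *: (d *: w3) = 0 ->
     a != b -> a != d -> w1 = 0.
    move=> T0 T1 T2 ab ad; apply/eqP.
    have : ((a - b) * (a - d)) *: w1 = 0.
      rewrite -[RHS](_ : a *: (a *: w1) + b *: (b *: w2) + d *: (d *: w3)
        - (b + d) *: (a *: w1 + b *: w2 + d *: w3) + (b * d) *: (w1 + w2 + w3) = _).
        by apply/rowP => i; rewrite !mxE; ring.
      by rewrite T0 T1 T2 !scaler0 subr0 addr0.
    by move=> /eqP; rewrite scaler_eq0 mulf_eq0 !subr_eq0 (negPf ab) (negPf ad).
  have u10 : u1 = 0 by apply: U S0 S1 S2 r12 r13.
  have u20 : u2 = 0.
    apply: (U r2 r1 r3 _ u1 u3) => //; rewrite 1?eq_sym//.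
    - by rewrite (addrC u2).
    - by rewrite (addrC (r2 *: _)).
    - by rewrite (addrC (r2 *: _)).
  have u30 : u3 = 0 by move: S0; rewrite u10 u20 !add0r.
  move: u10 u20 u30 => /eqP + /eqP + /eqP; rewrite !scaler_eq0.
  rewrite (negPf v10) (negPf v20) (negPf v30) !orbF.
  by case: (row_neq0P c0) => [|[]] /negPf ->.
have VM M a b c : (forall i j : 'I_3, bil M [:: v1; v2; v3]`_i [:: v1; v2; v3]`_j =
    diag3 a b c i j) -> V *m M *m V^T = diag3 a b c.
  by move=> e; apply/matrixP => i j; rewrite rows3_form e.
have [A12 B12] := orth _ _ _ _ r12 E1 E2.
have [A23 B23] := orth _ _ _ _ r23 E2 E3.
have [A13 B13] := orth _ _ _ _ r13 E1 E3.
have VA : V *m A *m V^T = diag3 (bil A v1 v1) (bil A v2 v2) (bil A v3 v3).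
  apply: VM; apply: ord3P; apply: ord3P; rewrite diag3E /eq_op /= !inordK //= bilC //.
have VB : V *m B *m V^T = diag3 (bil B v1 v1) (bil B v2 v2) (bil B v3 v3).
  apply: VM; apply: ord3P; apply: ord3P; rewrite diag3E /eq_op /= !inordK //= bilC //.
have [a10 a20 a30] : [/\ bil A v1 v1 != 0, bil A v2 v2 != 0 & bil A v3 v3 != 0].
  have : \det (V *m A *m V^T) != 0.
    by rewrite -unitfE -unitmxE !unitmx_mul uV uA unitmx_tr uV.
  by rewrite VA det_diag3 !mulf_eq0 !negb_or => /andP[/andP[? ?] ?].
rewrite (bB _ _ _ E1) (bB _ _ _ E2) (bB _ _ _ E3) in VB.
(* The eigenvalues of the pair are thus the numbers - 1 / ri, distinct because the roots are. *)
have q (t a : K) : t != 0 -> a != 0 -> a / (- t * a) = - t^-1 by move=> ? ?; field;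
  apply/andP.
have [||||||g Hg] := simdiag_of_diag uV VA VB; rewrite ?mulf_neq0 ?oppr_eq0//;
  last first.
- by exists g; do 3!eexists; exact: Hg.
all: by rewrite !q// eqr_opp (inj_eq invr_inj).
Qed.

End Pencils.

(** * The Cayley form as a quadratic form in its first argument *)

Section Polar.
Variable K : numClosedFieldType.
Implicit Types (A W D g : 'M[K]_3).

Definition sigma21_polar A W D := sigma21 (A + W) D - sigma21 A D - sigma21 W D.

Definition cayley_polar A W D :=
  4 * \det D * sigma21_polar A W D - 2 * sigma12 A D * sigma12 W D.

Let two0 : 2 != 0 :> K. Proof. by rewrite pnatr_eq0. Qed.

(** This coefficient is the trace of A times the adjugate of D, hence linear in A. *)
Lemma sigma12D A W D h : sigma12 (A + h *: W) D = sigma12 A D + h * sigma12 W D.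
Proof.
rewrite /sigma12 !det_mx33 !mxE.
set a00 := A _ _; set a01 := A _ _; set a02 := A _ _.
set a10 := A _ _; set a11 := A _ _; set a12 := A _ _.
set a20 := A _ _; set a21 := A _ _; set a22 := A _ _.
set w00 := W _ _; set w01 := W _ _; set w02 := W _ _.
set w10 := W _ _; set w11 := W _ _; set w12 := W _ _.
set w20 := W _ _; set w21 := W _ _; set w22 := W _ _.
by field.
Qed.

Lemma sigma21D A W D h : sigma21 (A + h *: W) D =
  sigma21 A D + h * sigma21_polar A W D + h ^+ 2 * sigma21 W D.
Proof.
rewrite /sigma21_polar /sigma21 !det_mx33 !mxE.
set a00 := A _ _; set a01 := A _ _; set a02 := A _ _.
set a10 := A _ _; set a11 := A _ _; set a12 := A _ _.
set a20 := A _ _; set a21 := A _ _; set a22 := A _ _.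
set w00 := W _ _; set w01 := W _ _; set w02 := W _ _.
set w10 := W _ _; set w11 := W _ _; set w12 := W _ _.
set w20 := W _ _; set w21 := W _ _; set w22 := W _ _.
by field.
Qed.

(* The polar form of a map satisfying the parallelogram law is additive. *)
Lemma sigma21_polarD A W W' D h :
  sigma21_polar A (W + h *: W') D = sigma21_polar A W D + h * sigma21_polar A W' D.
Proof.
have par X Y : sigma21 (X + Y) D = 2 * sigma21 X D + 2 * sigma21 Y D - sigma21 (X -
  Y) D.
  have := sigma21D X Y D (-1); rewrite scaleN1r => ->.
  by rewrite -{1}[Y]scale1r sigma21D; ring.
(* The Jordan-von Neumann argument: splitting the triple sum in two ways and eliminating the
   differences gives twice the identity. *)
have Q3 X Y Z : sigma21 (X + (Y + Z)) D = sigma21 (X + Y) D + sigma21 (X + Z) D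
    + sigma21 (Y + Z) D - sigma21 X D - sigma21 Y D - sigma21 Z D.
  have e1 : sigma21 (X + (Y + Z)) D =
      2 * sigma21 (X + Y) D + 2 * sigma21 Z D - sigma21 (X + Y - Z) D.
    by rewrite [X + (Y + Z)]addrA; exact: par.
  have e2 : sigma21 (X + (Y + Z)) D =
      2 * sigma21 (X + Z) D + 2 * sigma21 Y D - sigma21 (X - (Y - Z)) D.
    have -> : X - (Y - Z) = X + Z - Y by rewrite opprB addrA.
    by rewrite [Y + Z]addrC [X + (Z + Y)]addrA; exact: par.
  have e3 : sigma21 (X + Y - Z) D =
      2 * sigma21 X D + 2 * sigma21 (Y - Z) D - sigma21 (X - (Y - Z)) D.
    by rewrite -[X + Y - Z]addrA; exact: par.
  have e4 : sigma21 (Y - Z) D = 2 * sigma21 Y D + 2 * sigma21 Z D - sigma21 (Y + Z) D.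
    by rewrite (par Y Z); ring.
  apply: (mulfI two0); rewrite [LHS]mulr_natl [LHS]mulr2n {1}e1 e2 e3 e4; ring.
have QZ : sigma21 (h *: W') D = h ^+ 2 * sigma21 W' D.
  by rewrite -{1}[D]scale1r; have [-> _] := sigmaZ W' D h 1; rewrite mulr1.
by rewrite /sigma21_polar Q3 (sigma21D A W') QZ /sigma21_polar; ring.
Qed.

Lemma cayley_polarD A W W' D h :
  cayley_polar A (W + h *: W') D = cayley_polar A W D + h * cayley_polar A W' D.
Proof. by rewrite /cayley_polar sigma21_polarD sigma12D; ring. Qed.

Lemma cayley_formD A W D h : cayley_form (A + h *: W) D =
  cayley_form A D + h * cayley_polar A W D + h ^+ 2 * cayley_form W D.
Proof. by rewrite /cayley_form /cayley_polar sigma21D sigma12D; ring. Qed.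

Lemma cayley_polarE A W D :
  cayley_polar A W D = cayley_form (A + W) D - cayley_form A D - cayley_form W D.
Proof. by rewrite -[X in A + X]scale1r cayley_formD; ring. Qed.

(** Euler's relation: the polar form on the diagonal is twice the quadratic form. *)
Lemma cayley_polar_self A D : cayley_form A D = 0 -> cayley_polar A A D = 0.
Proof.
move=> e; rewrite cayley_polarE e -{1 2}[A]scale1r -scalerDl -[D in cayley_form _
  D]scale1r.
by rewrite cayley_formZ e; ring.
Qed.

(** Up to a power of det g, the derivatives along the first two diagonal directions are 2 (y + z -
    x) and 2 (x + z - y). They vanish together only if z = 0 and x = y, which distinct eigenvalues
    exclude. *)
Lemma cayley_polar_nondegenerate A D g x y z : simdiag A D g x y z ->
  exists W, W^T = W /\ cayley_polar A W D != 0.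
Proof.
move=> [ug -> -> [xy _ _]].
have dg : \det g != 0 by rewrite det_neq0.
have symW a b c : (g^T *m diag3 a b c *m g)^T = g^T *m diag3 a b c *m g.
  by rewrite !trmx_mul trmxK tr_diag_mx mulmxA.
have polE a b c : cayley_polar (g^T *m diag3 x y z *m g) (g^T *m diag3 a b c *m g)
  (g^T *m g)
   = \det g ^+ 4 * (4 * (x * b + a * y + y * c + b * z + x * c + a * z) -
     2 * (x + y + z) * (a + b + c)).
  rewrite cayley_polarE -mulmxDl -mulmxDr.
  have -> : diag3 x y z + diag3 a b c = diag3 (x + a) (y + b) (z + c).
    by apply/matrixP; apply: ord3P; apply: ord3P;
      rewrite !mxE /eq_op /= !inordK //= ?mulr1n ?mulr0n ?addr0.
  by rewrite !cayley_form_diag; ring.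
have [e|e] := eqVneq (y + z) x; last first.
  exists (g^T *m diag3 1 0 0 *m g); split; first exact: symW.
  rewrite polE (_ : _ - _ = 2 * (y + z - x)); last by ring.
  by rewrite !mulf_neq0 ?expf_neq0 ?subr_eq0.
exists (g^T *m diag3 0 1 0 *m g); split; first exact: symW.
rewrite polE (_ : _ - _ = 2 * (x + z - y)); last by ring.
rewrite !mulf_neq0 ?expf_neq0// subr_eq0; apply: contra xy => /eqP e'.
have z0 : z = 0.
  apply: (mulfI two0); rewrite mulr0; transitivity ((y + z - x) + (x + z - y)).
    by ring.
  by rewrite e e' !subrr addr0.
by rewrite -e z0 addr0.
Qed.

End Polar.

(** Used to replace a transition map, meaningful only on the image of a domain, by a local
    expression of it. *)
Lemma near_eq_differentiable (K : numFieldType) (V W : normedModType K)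
    (f g : V -> W) (x : V) :
  (\near x, f x = g x) -> differentiable f x -> differentiable g x.
Proof.
move=> fg df.
have fgx : f x = g x := nbhs_singleton fg.
have := diff_locally df => /eqaddoP fE.
have gE : g \o shift x = cst (g x) + 'd f x +o_ 0 id.
  apply/eqaddoP => e e0; have := fE e e0.
  have fg0 : \forall y \near (0 : V), f (y + x) = g (y + x).
    by move: fg; rewrite (near_shift 0) subr0 /=.
  by apply: filterS2 fg0 => y; rewrite /= !fctE /= fgx => ->.
have dgE : 'd g x = 'd f x :> (V -> W).
  by apply: diff_unique gE; exact: diff_continuous.
by apply/diff_locallyP; rewrite dgE; split=> //; exact: diff_continuous.
Qed.

(** * Submanifolds and their slice charts *)

Section SubManifold.
Variables (R : realType) (M : topologicalType).
Local Notation C := (complexes R).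

(** Near each point the transition factors through a chart of [A], with which both charts are
    compatible, and differentiability is local. *)
Lemma maximal_atlas_compatible n (A : set (chart R M n)) (phi psi : chart R M n) :
  complex_manifold A -> maximal_atlas A phi -> maximal_atlas A psi ->
  holomorphic_transition phi psi.
Proof.
move=> [_ _ Achart _ Acov] [[phio phii phic phiU] Aphi] [psich Apsi].
pose D := chart_dom phi `&` chart_dom psi.
(* One function has to serve at all points of the overlap, so the inverse of phi is built by choice
   on the image and [None] elsewhere. *)
pose inv (v : 'rV[C]_n) : option M :=
  if pselect (exists2 x, D x & phi x = v) is left e
  then Some (sval (cid2 e)) else None.
have invE x : D x -> inv (phi x) = Some x.
  move=> Dx; rewrite /inv; case: pselect => [e|[]]; last by exists x.
  case: (cid2 e) => y [yp _] /= /phii ->//; apply/mem_set => //.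
  by case: Dx.
exists (fun v => if inv v is Some x then psi x else 0) => x Dx.
rewrite (invE _ Dx); split=> //.
have [al Aal alx] := Acov x.
have [[f1 f1E] _] := Aphi _ Aal; have [_ [f2 f2E]] := Apsi _ Aal.
have [alo _ _ _] := Achart _ Aal; have [psio _ _ _] := psich.
pose W := D `&` chart_dom al.
have oW : open W by apply: openI => //; exact: openI.
have WD : W `<=` chart_dom phi by move=> y [[]].
have Wx : W x by split.
have oW' := phiU _ oW WD.
have [f1x df1] := f1E x (conj (WD _ Wx) alx).
have [f2x df2] := f2E x (conj alx (Dx.2)).
apply: (@near_eq_differentiable _ _ _ (f2 \o f1)); last first.
  by rewrite -f1x in df2; exact: differentiable_comp df1 df2.
have : nbhs (phi x) (phi @` W) by apply: open_nbhs_nbhs; split => //; exists x.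
apply: filterS => _ [y [Dy aly] <-] /=; rewrite invE//.
have [-> _] := f1E y (conj Dy.1 aly).
by have [-> _] := f2E y (conj aly Dy.2).
Qed.

End SubManifold.

Lemma differentiable_mulmxr (K : numFieldType) n p (P : 'M[K]_(n, p)) v :
  differentiable (fun w : 'rV[K]_n => w *m P) v.
Proof.
have -> : (fun w => w *m P) = \sum_(j < n) (fun w : 'rV[K]_n => w 0 j *: row j P).
  by apply/funext => w; rewrite fct_sumE mulmx_sum_row.
apply: differentiable_sum => j; apply: differentiableZl.
exact: differentiable_coord.
Qed.

Lemma differentiable_row_mx0 (K : numFieldType) d m v :
  differentiable (fun w : 'rV[K]_d => row_mx w (0 : 'rV[K]_m)) v.
Proof.
have -> : (fun w => row_mx w 0) = (fun w : 'rV[K]_d =>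
  w *m row_mx 1%:M (0 : 'M[K]_(d, m))).
  by apply/funext => w; rewrite mul_mx_row mulmx1 mulmx0.
exact: differentiable_mulmxr.
Qed.

Section SubManifold2.
Variables (R : realType) (M : topologicalType) (d m : nat).
Variables (A : set (chart R M (d + m))) (S : set M).

(** Along [S] the last m coordinates of a slice chart vanish, so the first d determine the point;
    padding with zeros is the holomorphic way back to the ambient coordinates. *)
Lemma induced_atlas_manifold : complex_manifold A ->
  (forall x, S x -> exists2 phi, slice_chart A S phi & chart_dom phi x) ->
  complex_manifold (@induced_atlas R M d m A S).
Proof.
move=> MA Scov; have [hM [B cB [Bo Bb]] _ _ _] := MA.
split.
- rewrite open_hausdorff => x y xy.
  have xy' : set_val x != set_val y by apply: contra xy => /eqP/val_inj ->.
  move: hM; rewrite open_hausdorff => /(_ _ _ xy')[[U V]] /= [Ux Vy] [oU oV /eqP UV0].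
  exists (set_val @^-1` U, set_val @^-1` V) => /=.
    by move: Ux Vy; rewrite !inE.
  split; [by exists U|by exists V|apply/eqP].
  by rewrite -preimage_setI UV0 preimage_set0.
- exists ((fun U => set_val @^-1` U) @` B).
    exact: card_le_trans (card_image_le _ _) cB.
  split; first by move=> _ [U BU <-]; exists U => //; exact: Bo.
  move=> x U [_ [[V oV <-] Vx VU]].
  have : nbhs (set_val x) V by apply: open_nbhs_nbhs.
  move=> /Bb[W [BW Wx] WV]; exists (set_val @^-1` W).
    by split => //; exists W.
  by apply: subset_trans VU => y /WV.
- move=> _ [phi [[[phio phii phic phiU] phiA] phiS] <-].
  have rs0 (x : S) : chart_dom phi (set_val x) -> rsubmx (phi (set_val x)) = 0.
    move=> px; have : (phi @` (chart_dom phi `&` S)) (phi (set_val x)).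
      by exists (set_val x) => //; split => //; exact: set_valP.
    by rewrite phiS => -[].
  split.
  + by exists (chart_dom phi).
  + move=> x y /set_mem px /set_mem py /= e; apply/val_inj.
    apply: phii; [exact: mem_set|exact: mem_set|].
    by rewrite -(hsubmxK (phi _)) -[RHS]hsubmxK e !rs0.
  + move=> x /set_mem px.
    apply: (@continuous_comp _ _ _ (fun x : S => phi (set_val x)) lsubmx).
      apply: (@continuous_comp _ _ _ (set_val : S -> M) phi).
        exact: initial_continuous.
      by apply: phic; exact: mem_set.
    exact: continuous_lsubmx.
  + move=> _ [V oV <-] Vphi.
    pose V' := V `&` chart_dom phi.
    have oV' : open (phi @` V').
      by apply: phiU; [exact: openI|move=> ? []].
    have -> : [set restrict_chart S phi x | x in set_val @^-1` V] =
        (fun w => row_mx w 0) @^-1` (phi @` V').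
      apply/seteqP; split => [_ [x Vx <-]|w] /=.
        exists (set_val x); first by split => //; exact: Vphi.
        by rewrite -[LHS]hsubmxK rs0//; exact: Vphi.
      move=> [x [Vx px] e].
      (* The converse inclusion of the slice condition: a point of the domain with vanishing last
         coordinates belongs to [S]. *)
      have : (phi @` chart_dom phi `&` [set v | rsubmx v = 0]) (phi x).
        by split; [exists x|rewrite e /= row_mxKr].
      rewrite -phiS => -[y [py Sy]] /phii yx.
      have {}yx : y = x by apply: yx; exact: mem_set.
      exists (SigSub (mem_set Sy) : S).
        by change (V y); rewrite yx.
      by change (lsubmx (phi y) = w); rewrite yx e row_mxKl.
    apply: open_comp oV' => w _; apply: differentiable_continuous.
    exact: differentiable_row_mx0.
- have key phi psi : slice_chart A S phi -> slice_chart A S psi ->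
      holomorphic_transition (restrict_chart S phi) (restrict_chart S psi).
    move=> [mphi phiS] [mpsi psiS].
    have [f fE] := maximal_atlas_compatible MA mphi mpsi.
    exists (fun w => lsubmx (f (row_mx w 0))) => x [px qx] /=.
    have e : row_mx (lsubmx (phi (set_val x))) 0 = phi (set_val x).
      rewrite -[RHS]hsubmxK; congr row_mx.
      have : (phi @` (chart_dom phi `&` S)) (phi (set_val x)).
        by exists (set_val x) => //; split => //; exact: set_valP.
      by rewrite phiS => -[].
    have [fx df] := fE _ (conj px qx); split; first by rewrite e fx.
    rewrite -e in df.
    have d1 := differentiable_comp (differentiable_row_mx0 _ _) df.
    exact: differentiable_comp d1 (differentiable_lsubmx _).
  by move=> _ _ [phi ? <-] [psi ? <-]; split; exact: key.
- move=> x; have [phi sphi px] := Scov _ (set_valP x).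
  by exists (restrict_chart S phi) => //; exists phi.
Qed.

End SubManifold2.

(** * Products of complex manifolds *)

Lemma row_mxE_mul (K : pzRingType) m n (a : 'rV[K]_m) (b : 'rV[K]_n) :
  row_mx a b = a *m row_mx 1%:M 0 + b *m row_mx 0 1%:M.
Proof. by rewrite !mul_mx_row !mulmx1 !mulmx0 add_row_mx addr0 add0r. Qed.

Lemma differentiable_row_mx (K : numFieldType) (V : normedModType K) m n
    (f : V -> 'rV[K]_m) (g : V -> 'rV[K]_n) v :
  differentiable f v -> differentiable g v ->
  differentiable (fun w => row_mx (f w) (g w)) v.
Proof.
move=> df dg; have -> : (fun w => row_mx (f w) (g w)) =
    ((fun a : 'rV[K]_m => a *m row_mx 1%:M 0) \o f) +
    ((fun b : 'rV[K]_n => b *m row_mx 0 1%:M) \o g).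
  by apply/funext => w; rewrite row_mxE_mul.
apply: differentiableD; apply: differentiable_comp; try exact: differentiable_mulmxr.
  exact: df.
exact: dg.
Qed.

Lemma continuous_row_mx (K : numFieldType) (T : topologicalType) m n
    (f : T -> 'rV[K]_m) (g : T -> 'rV[K]_n) x :
  {for x, continuous f} -> {for x, continuous g} ->
  {for x, continuous (fun w => row_mx (f w) (g w))}.
Proof.
move=> cf cg; have -> : (fun w => row_mx (f w) (g w)) =
    (fun w => ((fun a : 'rV[K]_m => a *m row_mx 1%:M 0) \o f) w +
    ((fun b : 'rV[K]_n => b *m row_mx 0 1%:M) \o g) w).
  by apply/funext => w; rewrite row_mxE_mul.
have mulc p q (P : 'M[K]_(p, q)) : continuous (fun a : 'rV[K]_p => a *m P).
  by move=> a; apply: differentiable_continuous; exact: differentiable_mulmxr.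
apply: cvgD.
  by apply: (@continuous_comp _ _ _ f (fun a => a *m _)); [exact: cf|exact: mulc].
by apply: (@continuous_comp _ _ _ g (fun a => a *m _)); [exact: cg|exact: mulc].
Qed.

Lemma open_setX (M N : topologicalType) (U : set M) (V : set N) :
  open U -> open V -> open (U `*` V).
Proof.
move=> oU oV; rewrite openE => -[a b] [/= Ua Vb]; exists (U, V) => //=.
by split; apply: open_nbhs_nbhs.
Qed.

Lemma open_setXP (M N : topologicalType) (U : set (M * N)) x :
  open U -> U x -> exists V W, [/\ open V, open W, V x.1, W x.2 & V `*` W `<=` U].
Proof.
rewrite openE => /[apply] -[[P Q]] /= [].
rewrite !nbhsE => -[V [oV Vx] VP] [W [oW Wx] WQ] PQU.
by exists V, W; split => // -[a b] [/= Va Wb]; apply: PQU; split; [exact: VP|exact: WQ].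
Qed.

Lemma hausdorff_setX (M N : topologicalType) :
  hausdorff_space M -> hausdorff_space N -> hausdorff_space (M * N)%type.
Proof.
rewrite !open_hausdorff => hM hN [a b] [c d] ne.
have [ac|ac] := eqVneq a c.
  have bd : b != d by apply: contra ne => /eqP <-; rewrite ac.
  have [[U V] /= [Ub Vd] [oU oV /eqP UV]] := hN _ _ bd.
  exists ([set: M] `*` U, [set: M] `*` V) => /=.
    by move: Ub Vd; rewrite !inE.
  split; [exact: open_setX openT oU|exact: open_setX openT oV|apply/eqP].
  by apply/seteqP; split => // -[x y] [[_ /= Uy] [_ /= Vy]];
    have : set0 y by rewrite -UV.
have [[U V] /= [Ub Vd] [oU oV /eqP UV]] := hM _ _ ac.
exists (U `*` [set: N], V `*` [set: N]) => /=.
  by move: Ub Vd; rewrite !inE.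
split; [exact: open_setX oU openT|exact: open_setX oV openT|apply/eqP].
by apply/seteqP; split => // -[x y] [[/= Uy _] [/= Vy _]]; have : set0 x by rewrite -UV.
Qed.

Lemma second_countable_setX (M N : topologicalType) :
  @second_countable M -> @second_countable N -> @second_countable (M * N)%type.
Proof.
move=> [B cB [Bo Bb]] [D cD [Do Db]].
exists ((fun UV => UV.1 `*` UV.2) @` (B `*` D)).
  exact: card_le_trans (card_image_le _ _) (countableX cB cD).
split; first by move=> _ [[U V] [/= BU DV] <-]; apply: open_setX; [exact: Bo|exact: Do].
move=> [a b] P [[U V] /= [/Bb[U' [BU Ua] UU] /Db[V' [DV Vb] VV]] UVP].
exists (U' `*` V'); first by split => //; exists (U', V').
by move=> [x y] [/= Ux Vy]; apply: UVP; split; [exact: UU|exact: VV].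
Qed.

Section ProductManifold.
Variables (R : realType) (M N : topologicalType) (m n : nat).
Variables (A : set (chart R M m)) (B : set (chart R N n)).

Lemma prod_chart_is_chart (phi : chart R M m) (psi : chart R N n) :
  is_chart phi -> is_chart psi -> is_chart (prod_chart phi psi).
Proof.
move=> [phio phii phic phiU] [psio psii psic psiU]; split.
- exact: open_setX.
- move=> [a b] [c d] /set_mem[/= pa qb] /set_mem[/= pc qd] /= /eq_row_mx[].
  by move=> /phii -> ; rewrite ?inE// => /psii -> ; rewrite ?inE.
- move=> [a b] /set_mem[/= pa qb];
  apply: (@continuous_row_mx (complexes R) _ m n (fun x => phi x.1) (fun x => psi x.2)).
    apply: (@continuous_comp _ _ _ fst phi); first exact: cvg_fst.
    by apply: phic; rewrite inE.
  apply: (@continuous_comp _ _ _ snd psi); first exact: cvg_snd.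
  by apply: psic; rewrite inE.
- move=> U oU Udom; rewrite openE => _ [[a b] Uab <-].
  have [V [W [oV oW Va Wb VWU]]] := open_setXP oU Uab.
  have [/= pa qb] := Udom _ Uab.
  pose V' := V `&` chart_dom phi; pose W' := W `&` chart_dom psi.
  have oV' : open (phi @` V') by apply: phiU; [exact: openI|move=> ? []].
  have oW' : open (psi @` W') by apply: psiU; [exact: openI|move=> ? []].
  apply: (@filterS _ _ _ (lsubmx @^-1` (phi @` V') `&` rsubmx @^-1` (psi @` W'))).
    move=> v [[x [Vx px] xv] [y [Wy qy] yv]] /=; exists (x, y); first exact: VWU.
    by rewrite /= xv yv hsubmxK.
  apply: open_nbhs_nbhs; split.
    apply: openI; [apply: open_comp oV'|apply: open_comp oW'] => v _.
      exact: continuous_lsubmx.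
    exact: continuous_rsubmx.
  by split; rewrite /= ?row_mxKl ?row_mxKr; [exists a|exists b].
Qed.

Lemma prod_manifold : complex_manifold A -> complex_manifold B ->
  complex_manifold (prod_atlas A B).
Proof.
move=> [hM cM Ach Acomp Acov] [hN cN Bch Bcomp Bcov]; split.
- exact: hausdorff_setX.
- exact: second_countable_setX.
- by move=> _ [phi Aphi [psi Bpsi <-]]; apply: prod_chart_is_chart;
  [exact: Ach|exact: Bch].
- have key phi phi' (psi psi' : chart R N n) :
      holomorphic_transition phi phi' -> holomorphic_transition psi psi' ->
      holomorphic_transition (prod_chart (phi : chart R M m) psi) (prod_chart phi'
        psi').
    move=> [f fE] [g gE].
    exists (fun v => row_mx (f (lsubmx v)) (g (rsubmx v))) =>
      -[a b] /= [[/= p q] [/= p' q']].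
    have [fa df] := fE _ (conj p p'); have [gb dg] := gE _ (conj q q').
    split; first by rewrite row_mxKl row_mxKr fa gb.
    rewrite -[phi a](row_mxKl _ (psi b)) in df;
      rewrite -[psi b](row_mxKr (phi a)) in dg.
    apply: differentiable_row_mx.
      exact: (differentiable_comp (differentiable_lsubmx _) df).
    exact: (differentiable_comp (differentiable_rsubmx _) dg).
  move=> _ _ [phi Aphi [psi Bpsi <-]] [phi' Aphi' [psi' Bpsi' <-]].
  have [? ?] := Acomp _ _ Aphi Aphi'; have [? ?] := Bcomp _ _ Bpsi Bpsi'.
  by split; exact: key.
- move=> [a b]; have [phi Aphi pa] := Acov a; have [psi Bpsi qb] := Bcov b.
  by exists (prod_chart phi psi) => //; exists phi => //; exists psi.
Qed.

End ProductManifold.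

(** * Entrywise continuity and differentiability *)

Lemma continuous_mx (K : topologicalType) (T : topologicalType) m n
    (f : T -> 'M[K]_(m, n)) x :
  (forall i j, {for x, continuous (fun y => f y i j)}) -> {for x, continuous f}.
Proof.
move=> cf U [P nP PU]; apply: (@filterS _ _ _ (fun y => forall i j, P i j (f y i j))).
  by move=> y Py; exact: PU.
by apply: filter_forall => i; apply: filter_forall => j; exact: (cf i j).
Qed.

Lemma differentiable_rV (K : numFieldType) (V : normedModType K) n
    (f : V -> 'rV[K]_n) x :
  (forall j, differentiable (fun y => f y 0 j) x) -> differentiable f x.
Proof.
move=> df; have -> : f = \sum_(j < n) (fun y => f y 0 j *: 'e_j).
  by apply/funext => w; rewrite fct_sumE [LHS]row_sum_delta.
by apply: differentiable_sum => j; apply: differentiableZl; exact: df.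
Qed.

Lemma open_neq0 (K : numFieldType) (V : normedModType K) : open [set v : V | v != 0].
Proof.
have -> : [set v : V | v != 0] = ~` [set 0].
  by apply/seteqP; split => u /= /eqP.
apply/closed_openC/accessible_closed_set1/hausdorff_accessible.
exact: norm_hausdorff.
Qed.

(** * Second countability of spaces of complex matrices *)

Section SecondCountable.
Variable R : realType.
Local Notation C := (complexes R).

Let qc (ab : rat * rat) : C := (ratr ab.1 +i* ratr ab.2)%C.

(** Radii of balls are complex numbers here; being positive makes them real, and the Archimedean
    property of [R] applies. *)
Let C_lt_inv (e : C) : 0 < e -> exists k : nat, (k.+1%:R^-1 : C) < e.
Proof.
move=> e0; have : (0 : C) <= e by exact: ltW.
case: e e0 => a b; rewrite ltcE /= => /andP[/eqP b0 a0] _.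
have [k ka] := ltr_add_invr a0; exists k; rewrite add0r in ka.
have -> : (k.+1%:R^-1 : C) = (k.+1%:R^-1 : R)%:C%C.
  by rewrite fmorphV rmorph_nat.
by rewrite ltcE /= b0 eqxx.
Qed.

Let qc_dense (z : C) (k : nat) : exists ab, `|z - qc ab| < k.+1%:R^-1.
Proof.
have e0 : (0 : R) < k.+1%:R^-1 / 2 by rewrite divr_gt0.
case: z => x y.
have q (t : R) : exists r, `|t - ratr r| < k.+1%:R^-1 / 2.
  have : t - k.+1%:R^-1 / 2 < t + k.+1%:R^-1 / 2 by rewrite ltrD2l gtrN.
  move=> /rat_in_itvoo[r]; rewrite in_itv /= => /andP[r1 r2]; exists r.
  by rewrite ltr_distlC r1.
have [a xa] := q x; have [b yb] := q y; exists (a, b).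
have -> : (x +i* y)%C - qc (a, b) = (x - ratr a)%:C%C + 'i%C * (y - ratr b)%:C%C.
  by apply/eqP; rewrite eq_complex /=; simpc.
apply: le_lt_trans (ler_normD _ _) _; rewrite normrM.
have nR (t : R) : `|t%:C%C : C| = (`|t|)%:C%C.
  by rewrite normc_def /= expr0n addr0 sqrtr_sqr.
have -> : `|'i%C : C| = 1 by rewrite normc_def /= expr0n expr1n add0r sqrtr1.
rewrite mul1r !nR -rmorphD /=.
have -> : (k.+1%:R^-1 : C) = (k.+1%:R^-1 : R)%:C%C by rewrite fmorphV rmorph_nat.
by rewrite ltcR (splitr (k.+1%:R^-1)) ltrD.
Qed.

(** The base consists of the balls with Gaussian rational centres and radii 1 / (k + 1). *)
Lemma second_countable_mx m n : @second_countable 'M[C]_(m, n).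
Proof.
pose b (Qk : 'M[rat * rat]_(m, n) * nat) :=
  ball (map_mx qc Qk.1) (Qk.2.+1%:R^-1 : C).
exists (range b).
  exact: card_le_trans (card_image_le _ _) (countableP _).
split; first by move=> _ [[Q k] _ <-]; apply: ball_open; rewrite invr_gt0 ltr0n.
move=> A U /nbhs_ballP[e /= e0 AU].
have [k ke] : exists k : nat, (k.+1%:R^-1 : C) < e / 2.
  by apply: C_lt_inv; rewrite divr_gt0.
have k0 : (0 : C) < k.+1%:R^-1 by rewrite invr_gt0 ltr0n.
have [Q AQ] : exists Q : 'M[rat * rat]_(m, n), forall i j, `|A i j - qc (Q i j)|
  < k.+1%:R^-1.
  have [f fE] := choice (fun ij : 'I_m * 'I_n => qc_dense (A ij.1 ij.2) k).
  by exists (\matrix_(i, j) f (i, j)) => i j; rewrite mxE; exact: (fE (i, j)).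
have bQA : ball (map_mx qc Q) (k.+1%:R^-1 : C) A.
  apply: ball_sym; split => // i j; rewrite mxE -ball_normE; exact: AQ.
exists (b (Q, k)); first by split => //; exists (Q, k).
move=> B QB; apply: AU; rewrite (splitr e).
apply: ball_triangle (le_ball (ltW ke) (ball_sym bQA)) (le_ball (ltW ke) QB).
Qed.

End SecondCountable.


(** * The space of conics as a complex manifold *)

Section Conic.
Variable R : realType.
Local Notation C := (complexes R).
Local Notation W := [set A : 'M[C]_3 | A^T = A].
Implicit Types (u v : 'rV[C]_6) (c d : conic R) (k l : 'I_6).

(** The position in [sym_coords] of the entry (i, j); the symmetry of the table makes [sym_mx]
    symmetric. *)
Definition sym_idx (i j : nat) : nat :=
  nth 0 (nth [::] [:: [:: 0; 1; 2]; [:: 1; 3; 4]; [:: 2; 4; 5]] i) j.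

Definition sym_mx u : 'M[C]_3 := \matrix_(i, j) u 0 (inord (sym_idx i j)).

Lemma sym_mx_sym u : (sym_mx u)^T = sym_mx u.
Proof.
apply/matrixP => i j; rewrite !mxE; congr (u _ (inord _)).
by case: i j => -[|[|[|//]]] ? [[|[|[|//]]] ?].
Qed.

Lemma sym_mxK u : sym_coords (sym_mx u) = u.
Proof.
apply/rowP => k; rewrite /sym_coords /entry !mxE /= !inordK //.
rewrite -[in RHS](inord_val k).
by case: k => -[|[|[|[|[|[|//]]]]]].
Qed.

Lemma sym_coordsK (A : 'M[C]_3) : A^T = A -> sym_mx (sym_coords A) = A.
Proof.
move=> sA; have AE i j : A i j = A j i by rewrite -{1}sA mxE.
apply/matrixP => i j; rewrite /sym_coords /entry !mxE.
rewrite -[in RHS](inord_val i) -[in RHS](inord_val j).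
by case: i j => -[|[|[|//]]] ? [[|[|[|//]]] ?]; rewrite inordK //= AE.
Qed.

Lemma sym_mxZ t u : sym_mx (t *: u) = t *: sym_mx u.
Proof. by apply/matrixP => i j; rewrite !mxE. Qed.

Lemma sym_coordsZ t (A : 'M[C]_3) : sym_coords (t *: A) = t *: sym_coords A.
Proof.
apply/rowP => k; rewrite /sym_coords /entry !mxE.
by case: k => -[|[|[|[|[|[|//]]]]]] //=; rewrite mxE.
Qed.

Lemma sym_coords0 : sym_coords (0 : 'M[C]_3) = 0.
Proof. by rewrite -[0 in LHS](scale0r 0) sym_coordsZ scale0r. Qed.

Lemma sym_mx0 : sym_mx 0 = 0.
Proof. by rewrite -[0 in LHS](scale0r 0) sym_mxZ scale0r. Qed.

Lemma sym_mx_eq0 u : (sym_mx u == 0) = (u == 0).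
Proof.
apply/eqP/eqP => [/(congr1 (@sym_coords R))|->]; last exact: sym_mx0.
by rewrite sym_mxK sym_coords0.
Qed.

Lemma continuous_sym_mx : continuous sym_mx.
Proof.
move=> u; apply: continuous_mx => i j.
rewrite (_ : (fun y => _) = (fun y : 'rV[C]_6 => y 0 (inord (sym_idx i j)))).
  exact: coord_continuous.
by apply/funext => y; rewrite mxE.
Qed.

Lemma continuous_sym_coords : continuous (@sym_coords R).
Proof.
move=> A; apply: continuous_mx => i k.
suff [a [b ->]] : exists a b, (fun y : 'M[C]_3 => sym_coords y i k) = (fun y => y a b).
  exact: coord_continuous.
case: k => -[|[|[|[|[|[|//]]]]]] p.
- by exists (inord 0), (inord 0); apply/funext => y; rewrite mxE.
- by exists (inord 0), (inord 1); apply/funext => y; rewrite mxE.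
- by exists (inord 0), (inord 2); apply/funext => y; rewrite mxE.
- by exists (inord 1), (inord 1); apply/funext => y; rewrite mxE.
- by exists (inord 1), (inord 2); apply/funext => y; rewrite mxE.
- by exists (inord 2), (inord 2); apply/funext => y; rewrite mxE.
Qed.

(** Replacing the zero vector makes the projection from C^6 to CP^5 a total function. *)
Definition nonzero_sym u : 'rV[C]_6 := if u == 0 then const_mx 1 else u.

Lemma nonzero_sym_subproof u :
  W (sym_mx (nonzero_sym u)) /\ sym_mx (nonzero_sym u) <> 0.
Proof.
split; first exact: sym_mx_sym.
apply/eqP; rewrite sym_mx_eq0 /nonzero_sym; case: ifPn => // _.
by apply/eqP => /rowP/(_ 0)/eqP; rewrite !mxE oner_eq0.
Qed.

Definition sym_vector u : nonzero_vectors W :=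
  SigSub (mem_set (nonzero_sym_subproof u)).

(* Junk at u = 0. *)
Definition conic_of u : conic R := \pi_(conic R) (sym_vector u).

Lemma sym_vectorE u : u != 0 -> set_val (sym_vector u) = sym_mx u.
Proof. by move=> u0; rewrite -[LHS]/(sym_mx (nonzero_sym u)) /nonzero_sym (negPf
  u0). Qed.

Lemma sym_vectorK (a : nonzero_vectors W) : sym_vector (sym_coords (set_val a)) = a.
Proof.
have [Wa a0] := set_valP a; apply: val_inj.
rewrite -[LHS]/(set_val (sym_vector _)) sym_vectorE; first exact: sym_coordsK.
by rewrite -sym_mx_eq0 sym_coordsK//; exact/eqP.
Qed.

Lemma conic_ofK c : conic_of (conic_coords c) = c.
Proof. by rewrite /conic_of /conic_coords /homogeneous sym_vectorK reprK. Qed.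

Lemma homogeneous_sym c : (homogeneous c)^T = homogeneous c.
Proof. by have [] := set_valP (repr (c : {eq_quot proportional_equiv_rel W})). Qed.

Lemma homogeneousE c : homogeneous c = sym_mx (conic_coords c).
Proof. by rewrite sym_coordsK// homogeneous_sym. Qed.

Lemma conic_coords_neq0 c : conic_coords c != 0.
Proof.
rewrite -sym_mx_eq0 -homogeneousE; apply/eqP.
by have [] := set_valP (repr (c : {eq_quot proportional_equiv_rel W})).
Qed.

Lemma conic_of_eqP u v : u != 0 -> v != 0 ->
  (conic_of u = conic_of v) <-> (exists2 k : C, k != 0 & u = k *: v).
Proof.
move=> u0 v0; split.
  move=> /eqmodP/asboolP[k k0]; rewrite !sym_vectorE// => /(congr1 (@sym_coords R)).
  by rewrite sym_coordsZ !sym_mxK => ->; exists k.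
move=> [k k0 e]; apply/eqmodP/asboolP; exists k => //.
by rewrite !sym_vectorE// e sym_mxZ.
Qed.

(** The scalar depends on the chosen representative without any regularity, so continuity arguments
    go through [conic_of] and scale-invariant expressions. *)
Lemma conic_coords_of u : u != 0 ->
  exists2 k : C, k != 0 & conic_coords (conic_of u) = k *: u.
Proof. by move=> u0; apply/conic_of_eqP => //;
  rewrite ?conic_coords_neq0 ?conic_ofK. Qed.

(** Transports the quotient topology from non-zero symmetric matrices to non-zero vectors of C^6,
    along the linear isomorphism [sym_mx]. *)
Lemma open_conicP (U : set (conic R)) :
  open U <-> open [set u | u != 0 /\ U (conic_of u)].
Proof.
split=> [oU|oO].
  have [V oV VE] : open (\pi_(conic R) @^-1` U) by [].
  have -> : [set u | u != 0 /\ U (conic_of u)] =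
      [set u | u != 0] `&` sym_mx @^-1` V.
    have e u : u != 0 -> U (conic_of u) <-> V (sym_mx u).
      move=> u0; rewrite -(sym_vectorE u0).
      by have -> : V (set_val (sym_vector u)) = U (conic_of u) :=
        congr1 (fun Z : set _ => Z (sym_vector u)) VE.
    by apply/seteqP; split => u [u0 /(e _ u0)].
  apply: openI; first exact: open_neq0.
  by apply: open_comp oV => u _; exact: continuous_sym_mx.
exists (@sym_coords R @^-1` [set u | u != 0 /\ U (conic_of u)]).
  by apply: open_comp oO => A _; exact: continuous_sym_coords.
apply/seteqP; split => a /=.
  by rewrite /conic_of sym_vectorK => -[].
have [Wa a0] := set_valP a.
rewrite /conic_of sym_vectorK; split=> //.
by rewrite -sym_mx_eq0 sym_coordsK//; exact/eqP.
Qed.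

(** The saturation of an open set is the union of its dilates, hence open. *)
Lemma open_conic_of (U : set 'rV[C]_6) : open U -> U `<=` [set u | u != 0] ->
  open (conic_of @` U).
Proof.
move=> oU U0; apply/open_conicP.
have -> : [set u | u != 0 /\ (conic_of @` U) (conic_of u)] =
    \bigcup_(k in [set k : C | k != 0]) ((fun u => k *: u) @^-1` U).
  apply/seteqP; split => u.
    move=> [u0 [v Uv /conic_of_eqP[||k k0 e]]] //; first exact: U0.
    by exists k => //; rewrite /preimage /= -e.
  move=> [k k0 Uku]; have := U0 _ Uku; rewrite /= scaler_eq0 negb_or => /andP[_ u0].
  split=> //; exists (k *: u) => //; apply/conic_of_eqP => //; first exact: U0.
  by exists k.
apply: bigcup_open => k _; apply: open_comp oU => u _.
exact: scaler_continuous.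
Qed.

Lemma continuous_conic_of u : u != 0 -> {for u, continuous conic_of}.
Proof.
move=> u0 P nP; have : nbhs (conic_of u) P by exact: nP.
rewrite nbhsE => -[U [oU Uu] UP];
  apply: (@filterS _ _ _ [set u | u != 0 /\ U (conic_of u)]).
  by move=> v [_ /UP].
by apply: open_nbhs_nbhs; split => //; apply/open_conicP.
Qed.

Lemma continuous_at_conic_of (T : topologicalType) (f : conic R -> T) u : u != 0 ->
  {for u, continuous (f \o conic_of)} -> {for conic_of u, continuous f}.
Proof.
move=> u0 cf P nP; have : nbhs u ((f \o conic_of) @^-1` P) by exact: cf.
rewrite nbhsE => -[U [oU Uu] UP].
apply: (@filterS _ _ _ (conic_of @` (U `&` [set u | u != 0]))).
  by move=> _ [v [/UP Pv _] <-].
apply: open_nbhs_nbhs; split; last by exists u.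
by apply: open_conic_of => [|v []//]; apply: openI => //; exact: open_neq0.
Qed.

Lemma second_countable_conic : @second_countable (conic R).
Proof.
have [B cB [Bo Bb]] := @second_countable_mx R 1 6.
exists ((fun U => conic_of @` (U `&` [set u | u != 0])) @` B).
  exact: card_le_trans (card_image_le _ _) cB.
split.
  move=> _ [U BU <-]; apply: open_conic_of => [|v []//].
  by apply: openI; [exact: Bo|exact: open_neq0].
move=> c P; rewrite -{1}(conic_ofK c) => /(continuous_conic_of (conic_coords_neq0 c)).
move=> /Bb[V [BV Vc] VP].
exists (conic_of @` (V `&` [set u | u != 0])).
  split; first by exists V.
  exists (conic_coords c); last exact: conic_ofK.
  by split => //; exact: conic_coords_neq0.
by move=> _ [v [Vv _] <-]; exact: VP.
Qed.

(** Distinct points have a non-zero 2 x 2 minor of coordinates. It stays non-zero on a product of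
    neighbourhoods, whose projections are then disjoint because proportional vectors have zero
    minors. *)
Lemma hausdorff_conic : hausdorff_space (conic R).
Proof.
rewrite open_hausdorff => c d cd.
have [u u0 cE] : exists2 u, u != 0 & conic_of u = c.
  by exists (conic_coords c); [exact: conic_coords_neq0|exact: conic_ofK].
have [v v0 dE] : exists2 u, u != 0 & conic_of u = d.
  by exists (conic_coords d); [exact: conic_coords_neq0|exact: conic_ofK].
have /rV0Pn[j vj] := v0.
have [i uv] : exists i, u 0 i * v 0 j - u 0 j * v 0 i != 0.
  apply: contrapT => H; case/negP: cd; apply/eqP.
  rewrite -cE -dE; apply/conic_of_eqP => //.
  have e : u = (u 0 j / v 0 j) *: v.
    apply/rowP => i; rewrite mxE; apply: (mulIf vj).
    rewrite mulrAC divfK//; apply/eqP; rewrite -subr_eq0.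
    by apply: contrapT => uv; apply: H; exists i; exact/negP.
  exists (u 0 j / v 0 j) => //; apply: contra u0 => /eqP k0.
  by rewrite e k0 scale0r.
pose h (p : 'rV[C]_6 * 'rV[C]_6) := p.1 0 i * p.2 0 j - p.1 0 j * p.2 0 i.
have ch : continuous h.
  have c1 k : continuous (fun p : 'rV[C]_6 * 'rV[C]_6 => p.1 0 k).
    move=> p; apply: (@continuous_comp _ _ _ fst (fun w : 'rV[C]_6 => w 0 k)).
      exact: cvg_fst.
    exact: coord_continuous.
  have c2 k : continuous (fun p : 'rV[C]_6 * 'rV[C]_6 => p.2 0 k).
    move=> p; apply: (@continuous_comp _ _ _ snd (fun w : 'rV[C]_6 => w 0 k)).
      exact: cvg_snd.
    exact: coord_continuous.
  move=> p; apply: cvgB; apply: cvgM; by [apply: c1|apply: c2].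
have oh : open (h @^-1` [set z | z != 0]).
  apply: open_comp; first by move=> p _; exact: ch.
  exact: open_neq0.
have [U [V [oU oV Uu Vv UV]]] := open_setXP oh (uv : (h @^-1` [set z | z != 0]) (u, v)).
have img (w : 'rV[C]_6) (O : set 'rV[C]_6) : open O -> O w -> w != 0 ->
    open (conic_of @` (O `&` [set u | u != 0])) /\
    (conic_of @` (O `&` [set u | u != 0])) (conic_of w).
  move=> oO Ow w0; split; last by exists w.
  by apply: open_conic_of => [|? []//]; apply: openI => //; exact: open_neq0.
have [oU' Uc] := img _ _ oU Uu u0; have [oV' Vd] := img _ _ oV Vv v0.
rewrite cE in Uc; rewrite dE in Vd.
exists (conic_of @` (U `&` [set u | u != 0]), conic_of @` (V `&` [set u |
  u != 0])) => /=.
  by rewrite !inE.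
split => //; apply/eqP/seteqP; split => // e [[x [Ux x0] <-] [y [Vy y0]]].
move=> /esym/(conic_of_eqP x0 y0)[k k0 xy].
have := UV (x, y) (conj Ux Vy); rewrite /= /h /= xy !mxE => /eqP; apply.
by ring.
Qed.

(** The inverse of the k-th affine chart, followed by [conic_of]. *)
Definition insert1 k (w : 'rV[C]_5) : 'rV[C]_6 :=
  \row_j (if unlift k j is Some i then w 0 i else 1).

Lemma insert1_id k w : insert1 k w 0 k = 1.
Proof. by rewrite mxE unlift_none. Qed.

Lemma insert1_lift k w j : insert1 k w 0 (lift k j) = w 0 j.
Proof. by rewrite mxE liftK. Qed.

Lemma insert1_neq0 k w : insert1 k w != 0.
Proof. by apply/eqP => /rowP/(_ k)/eqP; rewrite insert1_id mxE oner_eq0. Qed.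

Lemma insert1K k u : u 0 k != 0 ->
  insert1 k (col' k ((u 0 k)^-1 *: u)) = (u 0 k)^-1 *: u.
Proof.
move=> uk; apply/rowP => j; rewrite mxE.
by case: unliftP => [i ->|->]; rewrite !mxE ?mulVf.
Qed.

Lemma affine_chart_of k u : u != 0 ->
  (chart_dom (affine_chart R k) (conic_of u) <-> u 0 k != 0) /\
  affine_chart R k (conic_of u) = col' k ((u 0 k)^-1 *: u).
Proof.
move=> u0; rewrite /affine_chart /=; have [t t0 ->] := conic_coords_of u0.
rewrite mxE mulf_eq0 (negPf t0) /= scalerA; split => //.
have [->|uk] := eqVneq (u 0 k) 0; first by rewrite mulr0 !invr0 mul0r.
by congr (col' k (_ *: u)); field; rewrite t0 uk.
Qed.

Lemma affine_chartK k c : chart_dom (affine_chart R k) c ->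
  conic_of (insert1 k (affine_chart R k c)) = c.
Proof.
move=> ck; rewrite /= insert1K// -[RHS]conic_ofK; apply/conic_of_eqP.
- by rewrite scaler_eq0 invr_eq0 negb_or ck conic_coords_neq0.
- exact: conic_coords_neq0.
- by exists (conic_coords c 0 k)^-1 => //; rewrite invr_eq0.
Qed.

Lemma insert1_chartK k w :
  chart_dom (affine_chart R k) (conic_of (insert1 k w)) /\
  affine_chart R k (conic_of (insert1 k w)) = w.
Proof.
have [e ->] := affine_chart_of k (insert1_neq0 k w); split.
  by apply/e; rewrite insert1_id oner_eq0.
by apply/rowP => j; rewrite mxE insert1_id invr1 scale1r insert1_lift.
Qed.

Lemma differentiable_insert1 k w : differentiable (insert1 k) w.
Proof.
apply: differentiable_rV => j.
have [[i ->]|->] : (exists i, j = lift k i) \/ j = k.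
- by case: (unliftP k j) => [i ->|->]; [left; exists i|right].
- have -> : (fun y => insert1 k y 0 (lift k i)) = (fun y : 'rV[C]_5 => y 0 i).
    by apply/funext => y; rewrite insert1_lift.
  exact: differentiable_coord.
- have -> : (fun y => insert1 k y 0 k) = cst 1.
    by apply/funext => y; rewrite insert1_id.
  exact: differentiable_cst.
Qed.

Lemma differentiable_dehomogenize k u : u 0 k != 0 ->
  differentiable (fun u : 'rV[C]_6 => col' k ((u 0 k)^-1 *: u)) u.
Proof.
move=> uk; apply: differentiable_rV => j.
have -> : (fun y : 'rV[C]_6 => col' k ((y 0 k)^-1 *: y) 0 j) =
    (fun y => (y 0 k)^-1) * (fun y => y 0 (lift k j)).
  by apply/funext => y; rewrite !mxE.
apply: differentiableM; last exact: differentiable_coord.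
by apply: (differentiableV _ uk); exact: differentiable_coord.
Qed.

Lemma affine_chart_is_chart k : is_chart (affine_chart R k).
Proof.
split.
- apply/open_conicP.
  have -> : [set u | u != 0 /\ chart_dom (affine_chart R k) (conic_of u)] =
      (fun u : 'rV[C]_6 => u 0 k) @^-1` [set z | z != 0].
    apply/seteqP; split => u /=.
      by move=> [u0 uk]; apply/(affine_chart_of k u0).1.
    move=> uk; have u0 : u != 0 by apply: contra uk => /eqP ->; rewrite mxE.
    by split => //; apply/(affine_chart_of k u0).1.
  apply: open_comp; first by move=> p _; exact: coord_continuous.
  exact: open_neq0.
- move=> c d /set_mem ck /set_mem dk e.
  by rewrite -(affine_chartK ck) -(affine_chartK dk) e.
- move=> c /set_mem ck; rewrite -(conic_ofK c).
  apply: continuous_at_conic_of; first exact: conic_coords_neq0.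
  have dk := @differentiable_dehomogenize k (conic_coords c) ck.
  apply: differentiable_continuous; apply: near_eq_differentiable dk.
  apply: (@filterS _ _ _ [set u | u != 0]).
    by move=> u u0; have [_ e] := affine_chart_of k u0; exact: esym e.
  by apply: open_nbhs_nbhs; split; [exact: open_neq0|exact: conic_coords_neq0].
- move=> U oU Udom.
  have -> : affine_chart R k @` U = (conic_of \o insert1 k) @^-1` U.
    apply/seteqP; split => [_ [c Uc <-]|w Uw].
      by rewrite /= affine_chartK//; exact: Udom.
    by exists (conic_of (insert1 k w)) => //; have [] := insert1_chartK k w.
  apply: open_comp oU => w _; apply: continuous_comp.
    by apply: differentiable_continuous; exact: differentiable_insert1.
  by apply: continuous_conic_of; exact: insert1_neq0.
Qed.

Lemma conic_manifold : complex_manifold (conic_atlas R).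
Proof.
split.
- exact: hausdorff_conic.
- exact: second_countable_conic.
- by move=> _ [k _ <-]; exact: affine_chart_is_chart.
- have key k l : holomorphic_transition (affine_chart R k) (affine_chart R l).
    exists (fun w => col' l ((insert1 k w 0 l)^-1 *: insert1 k w)) => c [ck cl].
    have [e1 e2] := affine_chart_of l (insert1_neq0 k (affine_chart R k c)).
    rewrite (affine_chartK ck) in e1 e2; split; first by rewrite e2.
    have d := @differentiable_dehomogenize l _ (e1.1 cl).
    exact: (differentiable_comp (differentiable_insert1 _ _) d).
  by move=> _ _ [k _ <-] [l _ <-]; split; exact: key.
- move=> c; have /rV0Pn[k ck] := conic_coords_neq0 c.
  by exists (affine_chart R k) => //; exists k.
Qed.

End Conic.

(** * A holomorphic square root near 1 *)

Section SquareRoot.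
Variable K : numClosedFieldType.
Implicit Types (w z s : K).

(* The values of [sqrtC] have non-negative imaginary part, which makes it
   discontinuous along the positive reals. *)
Definition csqrt w : K := if 0 < 'Re (sqrtC w) then sqrtC w else - sqrtC w.

Lemma csqrtK w : csqrt w ^+ 2 = w.
Proof. by rewrite /csqrt; case: ifP => _; rewrite ?sqrrN sqrtCK. Qed.

Lemma csqrt_Re_ge0 w : 0 <= 'Re (csqrt w).
Proof.
rewrite /csqrt; case: ifPn => [/ltW//|]; rewrite raddfN oppr_ge0.
by rewrite -real_leNgt ?Creal_Re ?real0.
Qed.

Lemma sqr_csqrt z : 0 < 'Re z -> csqrt (z ^+ 2) = z.
Proof.
move=> z0; have /eqP := csqrtK (z ^+ 2); rewrite eqf_sqr => /orP[/eqP//|/eqP e].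
have := csqrt_Re_ge0 (z ^+ 2); rewrite e raddfN oppr_ge0 => /(lt_le_trans z0).
by rewrite ltxx.
Qed.

(** A purely imaginary root would make w a non-positive real, at distance at least 1 from 1. *)
Lemma csqrt_Re_gt0 w : `|w - 1| < 1 -> 0 < 'Re (csqrt w).
Proof.
move=> w1; rewrite lt_neqAle csqrt_Re_ge0 andbT eq_sym; apply/eqP => r0.
have wE : w = - 'Im (csqrt w) ^+ 2.
  by rewrite -{1}(csqrtK w) {1}(Crect (csqrt w)) r0 add0r exprMn sqrCi mulN1r.
have ge0 : 0 <= 'Im (csqrt w) ^+ 2 by rewrite real_exprn_even_ge0 ?Creal_Im.
move: w1; rewrite wE -opprD normrN ger0_norm ?addr_ge0 ?ler01//.
by rewrite -subr_lt0 addrK => /(le_lt_trans ge0); rewrite ltxx.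
Qed.

(** In the factorization of w0 - w as a difference of squares, the sum of the two roots has real
    part at least that of the root of w0, since all values of [csqrt] have non-negative real
    part. *)
Lemma csqrt_lip w w0 : `|w0 - 1| < 1 ->
  `|csqrt w0 - csqrt w| * 'Re (csqrt w0) <= `|w0 - w|.
Proof.
move=> w01; have r0 := csqrt_Re_gt0 w01.
have -> : w0 - w = (csqrt w0 - csqrt w) * (csqrt w0 + csqrt w).
  by rewrite -subr_sqr !csqrtK.
rewrite normrM ler_wpM2l//; have [le _] := leif_Re_Creal (csqrt w0 + csqrt w).
by apply: le_trans le; rewrite raddfD lerDl csqrt_Re_ge0.
Qed.

Lemma csqrt_continuous w0 : `|w0 - 1| < 1 -> {for w0, continuous csqrt}.
Proof.
move=> w01; have r0 := csqrt_Re_gt0 w01.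
move=> P /nbhs_ballP[e /= e0 eP]; apply/nbhs_ballP.
exists (e * 'Re (csqrt w0)); first by rewrite /= mulr_gt0.
move=> w; rewrite -ball_normE /= => we; apply: eP; rewrite -ball_normE /=.
by rewrite -(ltr_pM2r r0); exact: le_lt_trans (csqrt_lip _ w01) we.
Qed.

(** The difference quotient is the inverse of the sum of the two roots, so continuity is enough. *)
Lemma csqrt_derivable w0 : `|w0 - 1| < 1 -> derivable csqrt w0 1.
Proof.
move=> w01; have r0 := csqrt_Re_gt0 w01.
have s0 : csqrt w0 != 0.
  by apply/eqP => e; move: r0; rewrite e raddf0 ltxx.
apply: (cvgP ((csqrt w0 + csqrt w0)^-1)).
apply: (@cvg_trans _ ((fun h => (csqrt (h + w0) + csqrt w0)^-1) @ 0^')).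
  apply: near_eq_cvg; near=> h.
  have h0 : h != 0 by near: h; exact: nbhs_dnbhs_neq.
  have hE : h = (csqrt (h + w0) - csqrt w0) * (csqrt (h + w0) + csqrt w0).
    by rewrite -subr_sqr !csqrtK addrK.
  have [a0 b0] : csqrt (h + w0) - csqrt w0 != 0 /\ csqrt (h + w0) + csqrt w0 != 0.
    by move: h0; rewrite {1}hE mulf_eq0 negb_or => /andP[].
  rewrite /= [h%:A]mulr1; apply: (mulIf b0); rewrite mulVf//.
  rewrite -[_ *: _]/(_ * _) -mulrA -hE mulVf//.
apply: cvgV; first by rewrite -mulr2n mulrn_eq0.
apply: cvgD; last exact: cvg_cst.
apply: (@cvg_comp _ _ _ (fun h => h + w0) csqrt 0^' (nbhs w0)).
  have : (fun h : K => h + w0) @ (0 : K) --> w0.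
    move=> P nP; have : \near w0, P w0 by exact: nP.
    by rewrite (near_shift 0) subr0.
  by apply: cvg_trans; apply: cvg_app; exact: cvg_within.
exact: csqrt_continuous.
Unshelve. all: by end_near. Qed.

End SquareRoot.

(** * Taylor expansion of the square root of a polynomial *)

Lemma poly_is_derive (K : numFieldType) (p : {poly K}) (x : K) :
  is_derive x 1 (horner p) p^`().[x].
Proof.
elim/poly_ind: p => [|p c IH].
  have -> : horner 0 = cst 0 :> (K -> K) by apply/funext => y; rewrite horner0.
  by rewrite linear0 horner0; exact: is_derive_cst.
have -> : horner (p * 'X + c%:P) = horner p * id + cst c.
  by apply/funext => y; rewrite hornerMXaddC.
apply: is_derive_eq.
rewrite derivMXaddC hornerD hornerMX addr0 -![_ *: _]/(_ * _) /=.
by rewrite mulr1 (mulrC x).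
Qed.

Lemma poly_derivable (K : numFieldType) (p : {poly K}) (x : K) :
  derivable (horner p) x 1.
Proof. by have [] := poly_is_derive p x. Qed.

Lemma poly_derive (K : numFieldType) (p : {poly K}) (x : K) :
  'D_1 (horner p) x = p^`().[x].
Proof. by have [] := poly_is_derive p x. Qed.

Section SqrtBranch.
Variable R : realType.
Local Notation C := (complexes R).
Implicit Type p : {poly C}.

(** Dividing by p(0) brings the argument near 1, where [csqrt] is holomorphic. *)
Lemma sqrt_branch_exists p : p.[0] != 0 -> exists s, sqrt_branch (horner p) s.
Proof.
move=> p0; exists (fun t => sqrtC p.[0] * csqrt (p.[t] / p.[0])).
have d1 t : differentiable (fun t => p.[t] / p.[0]) t.
  apply/derivable1_diffP; apply: (@derivableM _ _ (horner p) (cst p.[0]^-1)).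
    exact: poly_derivable.
  exact: derivable_cst.
have ch := differentiable_continuous (d1 0).
have : \forall t \near (0 : C), `|p.[t] / p.[0] - 1| < 1.
  have /cvgrPdist_lt/(_ 1 ltr01) := ch; rewrite divff//.
  by apply: filterS => t; rewrite distrC.
apply: filterS => t t1; split; last by rewrite exprMn sqrtCK csqrtK mulrC divfK.
apply: derivableM; first exact: derivable_cst.
apply/derivable1_diffP.
have /derivable1_diffP d2 := csqrt_derivable t1.
exact: differentiable_comp (d1 t) d2.
Qed.

(** Comparing coefficients in s^2 = p gives 2 A_0 A_1 = p_1 and 2 A_0 A_2 + A_1^2 = p_2. *)
Lemma taylor_sqrt p s : p.[0] != 0 -> sqrt_branch (horner p) s ->
  taylor_coef s 2 = (4 * p.[0] * p`_2 - p`_1 ^+ 2) / (8 * p.[0] * s 0).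
Proof.
move=> p0 sp.
have two0 : 2 != 0 :> C by rewrite pnatr_eq0.
have p_nz : \forall t \near (0 : C), p.[t] != 0.
  have cp : {for 0, continuous (horner p)}.
    by apply/differentiable_continuous/derivable1_diffP; exact: poly_derivable.
  have : nbhs p.[0] [set z | z != 0].
    by apply: open_nbhs_nbhs; split => //; exact: open_neq0.
  exact: cp.
have s_nz : \forall t \near (0 : C), s t != 0.
  apply: filterS2 sp p_nz => t [_ e] pt; apply: contra pt => /eqP st.
  by rewrite -e st expr0n.
have ds : \forall t \near (0 : C), (s^`())%classic t = p^`().[t] / (2 * s t).
  (* Differentiating s^2 = p at a point t near 0 requires the identity on a neighbourhood of t. *)
  have /nbhs_interior sp' := sp.
  apply: filterS2 sp' s_nz => t spt st0.
  have [dst _] := nbhs_singleton spt.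
  have e : 'D_1 (s * s) t = p^`().[t].
    rewrite -poly_derive; apply: near_eq_derive.
    by apply: filterS spt => x [_ <-]; rewrite expr2.
  rewrite -e (deriveM dst dst) derive1E; apply/esym.
  by rewrite -[_ *: _]/(s t * 'D_1 s t); field; rewrite st0.
have [ds0 s02] := nbhs_singleton sp.
have s00 : s 0 != 0 by exact: nbhs_singleton s_nz.
have s'0 : 'D_1 s 0 = p^`().[0] / (2 * s 0).
  by rewrite -derive1E; exact: nbhs_singleton ds.
have d2 : derivable (fun t => 2 *: s t) 0 1 by exact: derivableZ.
have n2 : 2 *: s 0 != 0 by rewrite mulf_neq0.
have dp' : derivable (horner p^`()) 0 1 by exact: poly_derivable.
pose u (t : C) := 2 *: s t.
have du : derivable (fun t => (u t)^-1) 0 1 := @derivableV _ _ u 0 1 n2 d2.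
have M := @deriveM _ _ (horner p^`()) (fun t => (u t)^-1) 0 1 dp' du.
have uE : 'D_1 u 0 = 2 *: 'D_1 s 0 := deriveZ _ ds0.
rewrite (@deriveV _ _ u 0 1 n2 d2) uE s'0 poly_derive in M.
have E : (s^`(2))%classic 0 = 'D_1 (horner p^`() * (fun t => (u t)^-1)) 0.
  by rewrite derive1nS derive1n1 derive1E; exact: near_eq_derive ds.
rewrite /taylor_coef E M /u !horner_coef0 !coef_deriv.
rewrite -![_ *: _]/(_ * _) -horner_coef0 -s02.
have -> : 2`!%:R = 2 :> C by [].
by field; rewrite s00.
Qed.

End SqrtBranch.


(** * From conics to polynomial conditions on matrices *)

Section Projective.
Variables (R : realType) (m n : nat) (W : set 'M[complexes R]_(m, n)).
Local Notation C := (complexes R).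

Lemma homogeneousP (p : projectivization W) : W (homogeneous p) /\ homogeneous p != 0.
Proof. by have [? /eqP] :=
  set_valP (repr (p : {eq_quot proportional_equiv_rel W})). Qed.

Lemma projectivization_eqP (p q : projectivization W) :
  p = q <-> exists2 k : C, k != 0 & homogeneous p = k *: homogeneous q.
Proof.
split=> [->|e]; first by exists 1; rewrite ?oner_neq0 ?scale1r.
have pE (r : projectivization W) :
    r = \pi_(projectivization W) (repr (r : {eq_quot proportional_equiv_rel W})).
  by rewrite reprK.
by rewrite (pE p) (pE q); apply/eqmodP/asboolP.
Qed.

Lemma projectivization_point (v : 'M[C]_(m, n)) : W v -> v != 0 ->
  exists p : projectivization W, exists2 k : C, k != 0 & homogeneous p = k *: v.
Proof.
move=> Wv /eqP v0; pose a : nonzero_vectors W := SigSub (mem_set (conj Wv v0)).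
exists (\pi_(projectivization W) a).
have : \pi_(projectivization W) (repr (\pi_{eq_quot proportional_equiv_rel W} a)) =
    \pi_(projectivization W) a by rewrite reprK.
by move=> /eqmodP/asboolP.
Qed.

End Projective.

Section CayleySet.
Variable R : realType.
Local Notation C := (complexes R).
Implicit Types (c d : conic R) (A B : 'M[C]_3).

Lemma conic_pointsE c p :
  conic_points c p <-> bil (homogeneous c) (homogeneous p) (homogeneous p) = 0.
Proof.
rewrite /conic_points /= bilE; split=> [/matrixP/(_ 0 0)|->]; last exact: raddf0.
by rewrite !mxE mulr1n.
Qed.

Lemma four_pointsP c d :
  (conic_points c `&` conic_points d #= `I_4) <->
  exists p, four_points (homogeneous c) (homogeneous d) p.
Proof.
split.
  move=> /card_set_bijP[h [hfun hinj hsurj]].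
  have /choice[f fE] : forall i : 'I_4, exists q : CP2 R,
      (conic_points c `&` conic_points d) q /\ h q = i.
    by move=> i; have [q Sq hq] := hsurj i (ltn_ord i); exists q.
  exists (fun i => homogeneous (f i)); split.
  - by move=> i; have [] := homogeneousP (f i).
  - move=> i j [k e]; apply: ord_inj; have [_ <-] := fE i; have [_ <-] := fE j.
    congr h.
    apply/projectivization_eqP; exists k => //; apply/eqP => k0.
    by have [_ /eqP] := homogeneousP (f i); rewrite e k0 scale0r.
  - by move=> i; have [[/conic_pointsE ? /conic_pointsE ?] _] := fE i.
  - move=> u u0 cu du.
    have [q [k k0 qE]] := @projectivization_point R 1 3 setT u I u0.
    have Sq : (conic_points c `&` conic_points d) q.
      by split; apply/conic_pointsE; rewrite qE bilZl bilZr ?cu ?du !mulr0.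
    have q4 : (h q < 4)%N by exact: hfun.
    have [Sf hf] := fE (Ordinal q4).
    have fq : f (Ordinal q4) = q by apply: hinj; rewrite ?inE.
    by exists (Ordinal q4), k^-1; rewrite fq qE scalerA mulVf// scale1r.
move=> [p [p0 pinj pcd pall]].
have /choice[f fE] : forall i : 'I_4, exists q : CP2 R,
    exists2 k : C, k != 0 & homogeneous q = k *: p i.
  by move=> i; exact: projectivization_point.
suff /bijPex[g] : exists g, set_bij `I_4 (conic_points c `&` conic_points d) g.
  by rewrite card_eq_sym; exact: pcard_eq g.
exists (fun i => f (inord i)); split.
- move=> i /= i4; have [k k0 e] := fE (inord i); have [ci di] := pcd (inord i).
  by split; apply/conic_pointsE; rewrite e bilZl bilZr ?ci ?di !mulr0.
- move=> i j; rewrite !inE /= => i4 j4 /projectivization_eqP[k k0].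
  have [k1 k10 ->] := fE (inord i); have [k2 k20 ->] := fE (inord j).
  move=> /(congr1 (fun v => k1^-1 *: v)); rewrite !scalerA mulVf// scale1r => e.
  have /(congr1 val) : inord i = inord j :> 'I_4 by apply: pinj; eexists; exact: e.
  by rewrite /= !inordK.
- move=> q [/conic_pointsE cq /conic_pointsE dq].
  have [_ q0] := homogeneousP q; have [i [k e]] := pall _ q0 cq dq.
  exists (i : nat) => //=; rewrite inord_val; apply/projectivization_eqP.
  have [k1 k10 ->] := fE i; exists (k1 / k).
    rewrite mulf_neq0// invr_eq0; apply/eqP => k0.
    by move: q0; rewrite e k0 scale0r eqxx.
  rewrite e scalerA divfK//; apply/eqP => k0.
  by move: q0; rewrite e k0 scale0r eqxx.
Qed.

(** The algebraic form of the Cayley set. Each condition is invariant under separate rescaling of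
    [A] and [B], hence meaningful for conics. *)
Definition cayley_pair A B :=
  [/\ \det A != 0, \det B != 0, pencil_disc A B != 0 & cayley_form A B = 0].

Lemma cayley_pairZ A B (k l : C) : k != 0 -> l != 0 ->
  cayley_pair (k *: A) (l *: B) <-> cayley_pair A B.
Proof.
move=> k0 l0; rewrite /cayley_pair !detZ pencil_discZ cayley_formZ.
have e (a x : C) : a != 0 -> (a * x == 0) = (x == 0).
  by move=> /negPf a0; rewrite mulf_eq0 a0.
have [k2 k3 k6] : [/\ k ^+ 2 != 0, k ^+ 3 != 0 & k ^+ 6 != 0].
  by rewrite !expf_neq0.
have [l3 l4 l6] : [/\ l ^+ 3 != 0, l ^+ 4 != 0 & l ^+ 6 != 0].
  by rewrite !expf_neq0.
rewrite !(e _ _ k3) !(e _ _ l3) (e _ _ (mulf_neq0 k6 l6));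
  split=> -[-> -> -> /eqP h]; split => //; apply/eqP.
  by rewrite (e _ _ (mulf_neq0 k2 l4)) in h.
by rewrite (e _ _ (mulf_neq0 k2 l4)).
Qed.

Lemma transverse_pairsP c d : let A := homogeneous c in let B := homogeneous d in
  transverse_pairs (c, d) <-> [/\ \det A != 0, \det B != 0 & pencil_disc A B != 0].
Proof.
move=> A B; have [sA sB] : A^T = A /\ B^T = B by rewrite !homogeneous_sym.
have unitE (M : 'M[C]_3) : \det M != 0 -> M \in unitmx by rewrite det_neq0.
split=> -[/= dA dB].
  move=> /four_pointsP[p Hp]; split => //.
  have [g [x [y [z [ug -> -> [xy yz xz]]]]]] :=
    four_points_simdiag sA sB (unitE _ dA) (unitE _ dB) Hp.
  rewrite pencil_disc_diag mulf_neq0 ?expf_neq0 ?mulf_neq0 ?subr_eq0//.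
move=> d0; split => //; apply/four_pointsP.
have [g [x [y [z Hs]]]] := simdiag_of_disc sA sB (unitE _ dA) (unitE _ dB) d0.
exact: simdiag_four_points Hs.
Qed.

Lemma pencil_horner A B : (fun t => \det (t *: A + B)) =
  horner ((\det A)%:P * 'X^3 + (sigma21 A B)%:P * 'X^2
          + (sigma12 A B)%:P * 'X + (\det B)%:P).
Proof.
apply/funext => t; rewrite -[X in _ + X]scale1r det_pencil.
by rewrite !(hornerD, hornerCM, hornerXn, hornerX, hornerC); ring.
Qed.

Lemma cayley_setP c d :
  cayley_set R (c, d) <-> cayley_pair (homogeneous c) (homogeneous d).
Proof.
rewrite /cayley_set /cayley_pair /=.
set A := homogeneous c; set B := homogeneous d.
rewrite pencil_horner; set p := (X in horner X).
have pE i : p`_i = [:: \det B; sigma12 A B; sigma21 A B; \det A]`_i.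
  rewrite /p !coefD !coefCM !coefXn coefX coefC.
  by case: i => [|[|[|[|i]]]] /=; rewrite ?nth_nil ?mulr0n ?mulr1n; ring.
have p0E : p.[0] = \det B by rewrite horner_coef0 pE.
have tay s : \det B != 0 -> sqrt_branch (horner p) s ->
    taylor_coef s 2 = cayley_form A B / (8 * \det B * s 0).
  by move=> dB hs; rewrite (taylor_sqrt _ hs) p0E// !pE.
have s0 s : \det B != 0 -> sqrt_branch (horner p) s -> s 0 != 0.
  move=> dB hs; have [_ e] := nbhs_singleton hs; apply: contra dB => /eqP s0.
  by rewrite -p0E -e s0 expr0n.
have n8 : 8 != 0 :> C by rewrite pnatr_eq0.
split.
  move=> [/transverse_pairsP[dA dB d0] [s [hs]]]; rewrite tay// => /eqP.
  rewrite mulf_eq0 invr_eq0 !mulf_eq0 (negPf n8) (negPf dB) (negPf (s0 _ dB hs)).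
  by rewrite !orbF => /eqP.
move=> [dA dB d0 e]; split; first by apply/transverse_pairsP.
have [|s hs] := @sqrt_branch_exists R p; first by rewrite p0E.
by exists s; split => //; rewrite tay// e mul0r.
Qed.

Lemma cayley_set_of u v : u != 0 -> v != 0 ->
  cayley_set R (conic_of u, conic_of v) <-> cayley_pair (sym_mx u) (sym_mx v).
Proof.
move=> u0 v0; rewrite cayley_setP !homogeneousE.
have [k k0 ->] := conic_coords_of u0; have [l l0 ->] := conic_coords_of v0.
by rewrite !sym_mxZ; exact: cayley_pairZ.
Qed.

End CayleySet.

Lemma continuous_mulmx (K : numFieldType) (T : topologicalType) m n p
    (f : T -> 'M[K]_(m, n)) (g : T -> 'M[K]_(n, p)) x :
  {for x, continuous f} -> {for x, continuous g} ->
  {for x, continuous (fun y => f y *m g y)}.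
Proof.
move=> cf cg; apply: continuous_mx => i j.
have ce a b (h : T -> 'M[K]_(a, b)) k l : {for x, continuous h} ->
    {for x, continuous (fun y => h y k l)}.
  move=> ch; apply: (@continuous_comp _ _ _ h (fun M : 'M[K]_(a, b) => M k l)) => //.
  exact: coord_continuous.
have H (s : seq 'I_n) : {for x, continuous (fun y => \sum_(k <- s) f y i k * g y k j)}.
  elim: s => [|k s IH].
    rewrite (_ : (fun y => _) = cst 0); first exact: cvg_cst.
    by apply/funext => y; rewrite big_nil.
  rewrite (_ : (fun y => _) = (fun y => f y i k * g y k j +
    (fun y => \sum_(k <- s) f y i k * g y k j) y)); last first.
    by apply/funext => y; rewrite big_cons.
  by apply: cvgD => //; apply: cvgM; apply: ce.
rewrite (_ : (fun y => _) = (fun y => \sum_(k <- index_enum 'I_n) f y i k * g y k j)).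
  exact: H.
by apply/funext => y; rewrite mxE.
Qed.

Lemma continuous_trmx (K : numFieldType) (T : topologicalType) m n
    (f : T -> 'M[K]_(m, n)) x :
  {for x, continuous f} -> {for x, continuous (fun y => (f y)^T)}.
Proof.
move=> cf; apply: continuous_mx => i j.
rewrite (_ : (fun y => _) = (fun y => f y j i)); last first.
  by apply/funext => y; rewrite mxE.
apply: (@continuous_comp _ _ _ f (fun M : 'M[K]_(m, n) => M j i)) => //.
exact: coord_continuous.
Qed.

Section Connected.
Variable R : realType.
Local Notation C := (complexes R).
Implicit Types (g : 'M[C]_3) (p q : C).

Lemma real_complex_continuous : continuous (fun t : R => t%:C%C : C).
Proof.
move=> t P /nbhs_ballP[e /= e0 eP]; apply/nbhs_ballP.
case: e e0 eP => a b; rewrite ltcE /= => /andP[/eqP b0 a0] eP.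
exists a => // s; rewrite -ball_normE /= => ts; apply: eP; rewrite -ball_normE /=.
rewrite -rmorphB normc_def /= expr0n addr0 sqrtr_sqr ltcE /= ts andbT.
by rewrite b0.
Qed.

(* For distinct values of s the arcs t + i s t (1 - t) from 0 to 1 meet only at
   their end points, so that all but finitely many of them avoid the roots. *)
Lemma arc_avoiding_roots (r : {poly C}) : r.[0] != 0 -> r.[1] != 0 ->
  exists z : R -> C, [/\ continuous z, z 0 = 0, z 1 = 1 &
    forall t, 0 <= t <= 1 -> r.[z t] != 0].
Proof.
move=> r0 r1; have [rs rE] := closed_field_poly_normal r.
pose l := [seq complex.Im (w : R[i]) / (complex.Re (w : R[i]) * (1 -
  complex.Re (w : R[i]))) | w <- rs].
have [s sl] : exists s, s \notin l.
  have [s H] : exists s : R, all (fun x => x < s) l.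
    elim: l => [|x l [s H]]; first by exists 0.
    exists (Num.max s (x + 1)) => /=; rewrite lt_max ltrDl ltr01 orbT /=.
    by apply: sub_all H => y ys; rewrite lt_max ys.
  by exists s; apply/negP => /(allP H); rewrite ltxx.
pose z (t : R) : C := t%:C%C + t%:C%C * (1 - t%:C%C) * ('i%C * s%:C%C).
have zE t : z t = (t +i* (t * (1 - t) * s))%C.
  rewrite /z; have -> : 1 - t%:C%C = (1 - t)%:C%C :> C by rewrite rmorphB rmorph1.
  by rewrite [RHS]complexE /= !rmorphM /=; ring.
exists z; split.
- pose r' : {poly C} := 'X + 'X * (1%:P - 'X) * ('i%C * s%:C%C)%:P.
  have -> : z = (fun t => r'.[t%:C%C]).
    by apply/funext => t; rewrite /z /r' !(hornerD, hornerM, hornerN, hornerX, hornerC).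
  move=> t; apply: (@continuous_comp _ _ _ (fun t : R => t%:C%C : C) (horner r')).
    exact: real_complex_continuous.
  by apply/differentiable_continuous/derivable1_diffP; exact: poly_derivable.
- by rewrite /z rmorph0 !mul0r addr0.
- by rewrite /z rmorph1 subrr mulr0 mul0r addr0.
move=> t /andP[t0 t1]; apply/negP => rz.
have tn0 : t != 0.
  by apply: contra r0 => /eqP e; move: rz; rewrite e /z rmorph0 !mul0r addr0.
have tn1 : 1 - t != 0.
  rewrite subr_eq0; apply: contra r1 => /eqP e; move: rz.
  by rewrite -e /z rmorph1 subrr mulr0 mul0r addr0.
have zrs : z t \in rs.
  have rn0 : lead_coef r != 0.
    by rewrite lead_coef_eq0; apply: contra r0 => /eqP ->; rewrite horner0.
  by move: rz; rewrite rE hornerZ mulf_eq0 (negPf rn0) /= -[_ == 0]/(root _ _)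
    root_prod_XsubC.
case/negP: sl; apply/mapP; exists (z t) => //.
by rewrite zE /=; field; apply/andP.
Qed.

Lemma continuous_line m n (a b : 'M[C]_(m, n)) : continuous (fun z : C => a + z *: b).
Proof.
move=> z; apply: continuous_mx => i j.
rewrite (_ : (fun y => _) = horner ((b i j)%:P * 'X + (a i j)%:P)); last first.
  by apply/funext => y; rewrite hornerD hornerCM hornerX hornerC !mxE addrC mulrC.
by apply/differentiable_continuous/derivable1_diffP; exact: poly_derivable.
Qed.

Definition gram (M : 'M[C]_3) : conic R := conic_of (sym_coords (M^T *m M)).

Lemma gramK (M : 'M[C]_3) : sym_mx (sym_coords (M^T *m M)) = M^T *m M.
Proof. by rewrite sym_coordsK// trmx_mul trmxK. Qed.

Lemma gram_neq0 (M : 'M[C]_3) : \det M != 0 -> sym_coords (M^T *m M) != 0.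
Proof.
move=> d; rewrite -sym_mx_eq0 gramK; apply: contra d => /eqP e.
have : \det (M^T *m M) = 0 by rewrite e det0.
by rewrite det_mulmx det_tr => /eqP; rewrite mulf_eq0 orbb.
Qed.

Lemma gram_continuous (T : topologicalType) (f : T -> 'M[C]_3) x :
  \det (f x) != 0 -> {for x, continuous f} -> {for x, continuous (fun y => gram (f y))}.
Proof.
move=> d cf.
apply: (@continuous_comp _ _ _ (fun y => sym_coords ((f y)^T *m f y)) (@conic_of R)).
  apply: (@continuous_comp _ _ _ (fun y => (f y)^T *m f y) (@sym_coords R)).
    exact: (@continuous_mulmx _ _ _ _ _ (fun y => (f y)^T) f x
      (@continuous_trmx _ _ _ _ f x cf) cf).
  exact: continuous_sym_coords.
by apply: continuous_conic_of; exact: gram_neq0.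
Qed.

Definition side (p q : C) : 'M[C]_3 := diag3 p q (p + q).

Definition cayley_param g p q : conic R * conic R :=
  (gram (side p q *m g), gram g).

Definition admissible g p q := \det g != 0 /\
  p * q * (p + q) * (p - q) * (2 * p + q) * (p + 2 * q) != 0.

Lemma side_gram g p q : (side p q *m g)^T *m (side p q *m g) =
  g^T *m diag3 (p ^+ 2) (q ^+ 2) ((p + q) ^+ 2) *m g.
Proof.
rewrite trmx_mul tr_diag_mx -!mulmxA; congr (_ *m _); rewrite !mulmxA; congr (_ *m _).
rewrite mulmx_diag; congr diag_mx; apply/rowP; apply: ord3P;
  by rewrite !mxE !inordK //= expr2.
Qed.

Lemma cayley_param_in g p q : admissible g p q -> cayley_set R (cayley_param g p q).
Proof.
move=> [dg]; rewrite !mulf_eq0 !negb_or.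
move=> /andP[/andP[/andP[/andP[/andP[p0 q0] pq] pmq] p2q] pq2].
have dside : \det (side p q) != 0 by rewrite det_diag3 !mulf_neq0.
apply/cayley_set_of; [apply: gram_neq0;
  by rewrite det_mulmx mulf_neq0|exact: gram_neq0|].
rewrite !gramK side_gram; split.
- by rewrite !det_mulmx det_tr det_diag3 !mulf_neq0 ?expf_neq0.
- by rewrite det_mulmx det_tr mulf_neq0.
- rewrite pencil_disc_diag.
  have -> : p ^+ 2 - q ^+ 2 = (p + q) * (p - q) by ring.
  have -> : q ^+ 2 - (p + q) ^+ 2 = - (p * (p + 2 * q)) by ring.
  have -> : p ^+ 2 - (p + q) ^+ 2 = - (q * (2 * p + q)) by ring.
  by rewrite mulf_neq0 ?expf_neq0// !mulf_neq0 ?oppr_eq0 ?mulf_neq0.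
- by rewrite cayley_form_diag (_ : _ - _ = 0) ?mulr0//; ring.
Qed.

Lemma cayley_param_onto cd : cayley_set R cd ->
  exists g p q, admissible g p q /\ cd = cayley_param g p q.
Proof.
case: cd => c d /cayley_setP[dA dB d0 e].
have [sA sB] := (homogeneous_sym c, homogeneous_sym d).
have uA : homogeneous c \in unitmx by move: dA; rewrite det_neq0.
have uB : homogeneous d \in unitmx by move: dB; rewrite det_neq0.
have [g [x [y [z [ug AE BE [xy yz xz]]]]]] := simdiag_of_disc sA sB uA uB d0.
have dg : \det g != 0 by rewrite det_neq0.
move: e dA; rewrite AE BE cayley_form_diag => /eqP.
rewrite mulf_eq0 expf_eq0 (negPf dg) andbF orFb => /eqP /heron_param[p [q [xE yE zE]]].
rewrite !det_mulmx det_diag3 xE yE zE => dA; exists g, p, q; split; last first.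
  rewrite /cayley_param /gram side_gram -xE -yE -zE -AE -BE.
  by rewrite -[sym_coords (homogeneous c)]/(conic_coords c) -[sym_coords
    (homogeneous d)]/(conic_coords d) !conic_ofK.
split => //; move: xy yz xz;
  rewrite xE yE zE -subr_eq0 -[q ^+ 2 == _]subr_eq0 -[p ^+ 2 == (p + q) ^+ 2]subr_eq0.
have -> : p ^+ 2 - q ^+ 2 = (p + q) * (p - q) by ring.
have -> : q ^+ 2 - (p + q) ^+ 2 = - (p * (p + 2 * q)) by ring.
have -> : p ^+ 2 - (p + q) ^+ 2 = - (q * (2 * p + q)) by ring.
rewrite !oppr_eq0 !mulf_eq0 !negb_or => /andP[n1 n2] /andP[n3 n4] /andP[n5 n6].
by rewrite n1 n2 n3 n4 n5 n6.
Qed.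

Lemma cayley_arc g0 p0 q0 g1 p1 q1 : admissible g0 p0 q0 -> admissible g1 p1 q1 ->
  exists T : set (conic R * conic R), [/\ connected T, T `<=` cayley_set R,
    T (cayley_param g0 p0 q0) & T (cayley_param g1 p1 q1)].
Proof.
move=> a0 a1.
pose line (a b : C) : {poly C} := (b - a)%:P * 'X + a%:P.
have lineE a b z : (line a b).[z] = a + z * (b - a).
  by rewrite /line hornerD hornerCM hornerX hornerC mulrC addrC.
pose G z := g0 + z *: (g1 - g0).
pose P z := p0 + z * (p1 - p0); pose Q z := q0 + z * (q1 - q0).
have [dG dGE] : exists r : {poly C}, forall z, r.[z] = \det (G z).
  have := pencil_horner (g1 - g0) g0; set r := (X in horner X) => rE.
  by exists r => z; rewrite -[LHS]/((horner r) z) -rE addrC.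
pose r := dG * (line p0 p1 * line q0 q1 * line (p0 + q0) (p1 + q1) * line (p0 -
  q0) (p1 - q1)
   * line (2 * p0 + q0) (2 * p1 + q1) * line (p0 + 2 * q0) (p1 + 2 * q1)).
have rP z : r.[z] != 0 <-> admissible (G z) (P z) (Q z).
  rewrite /r hornerM dGE mulf_eq0 negb_or /admissible !hornerM !lineE.
  have -> : p0 + q0 + z * (p1 + q1 - (p0 + q0)) = P z + Q z by rewrite /P /Q; ring.
  have -> : p0 - q0 + z * (p1 - q1 - (p0 - q0)) = P z - Q z by rewrite /P /Q; ring.
  have -> : 2 * p0 + q0 + z * (2 * p1 + q1 - (2 * p0 + q0)) = 2 * P z + Q z
    by rewrite /P /Q; ring.
  have -> : p0 + 2 * q0 + z * (p1 + 2 * q1 - (p0 + 2 * q0)) = P z + 2 * Q z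
    by rewrite /P /Q; ring.
  by split => /andP.
have [G0 P0 Q0] : [/\ G 0 = g0, P 0 = p0 & Q 0 = q0].
  by rewrite /G /P /Q scale0r !mul0r !addr0.
have [G1 P1 Q1] : [/\ G 1 = g1, P 1 = p1 & Q 1 = q1].
  by rewrite /G /P /Q scale1r !mul1r !(addrC _ (_ - _)) !subrK.
have r0 : r.[0] != 0 by apply/rP; rewrite G0 P0 Q0.
have r1 : r.[1] != 0 by apply/rP; rewrite G1 P1 Q1.
have [z [cz z0 z1 zr]] := arc_avoiding_roots r0 r1.
pose h (t : R) := cayley_param (G (z t)) (P (z t)) (Q (z t)).
exists (h @` `[0, 1]); split.
- apply: connected_continuous_connected.
    by apply/connected_intervalP; exact: interval_is_interval.
  apply: continuous_in_subspaceT => t /set_mem; rewrite /= in_itv /= => /zr/rP[dg pq].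
  have cG : {for t, continuous (fun t => G (z t))}.
    apply: (@continuous_comp _ _ _ z (fun w => g0 + w *: (g1 - g0))); first exact: cz.
    exact: continuous_line.
  have sideE w : side (P w) (Q w) = side p0 q0 + w *: (side p1 q1 - side p0 q0).
    apply/matrixP; apply: ord3P; apply: ord3P;
      rewrite !mxE /eq_op /= !inordK //= /P /Q; ring.
  have cS : {for t, continuous (fun t => side (P (z t)) (Q (z t)))}.
    rewrite (_ : (fun t => _) = (fun w =>
      side p0 q0 + w *: (side p1 q1 - side p0 q0)) \o z).
      apply: continuous_comp; first exact: cz.
      exact: continuous_line.
    by apply/funext => y; rewrite /= sideE.
  move: pq; rewrite !mulf_eq0 !negb_or.
  move=> /andP[/andP[/andP[/andP[/andP[n1 n2] n3] _] _] _].
  have cSG := @continuous_mulmx _ _ _ _ _ (fun t => side (P (z t)) (Q (z t)))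
    (fun t => G (z t)) t cS cG.
  have c2 := @gram_continuous _ (fun t => G (z t)) t dg cG.
  have c1 := @gram_continuous _ (fun t => side (P (z t)) (Q (z t)) *m G (z t)) t _ cSG.
  apply: (@cvg_pair _ _ _ _ _ _ _ _ _ _ _ (c1 _) c2).
  by rewrite det_mulmx det_diag3 !mulf_neq0.
- by move=> _ [t /= /[!in_itv]/= /zr/rP a <-]; exact: cayley_param_in.
- by exists 0; rewrite /= ?in_itv /= ?lexx ?ler01 // /h z0 G0 P0 Q0.
- by exists 1; rewrite /= ?in_itv /= ?lexx ?ler01 // /h z1 G1 P1 Q1.
Qed.

Lemma admissible1 : admissible 1%:M 1 2.
Proof.
split; first by rewrite det1 oner_eq0.
rewrite (_ : _ * _ = - 120); last by ring.
by rewrite oppr_eq0 pnatr_eq0.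
Qed.

Lemma cayley_set_neq0 : cayley_set R !=set0.
Proof. by exists (cayley_param 1%:M 1 2); apply: cayley_param_in;
  exact: admissible1. Qed.

Lemma cayley_set_connected : connected (cayley_set R).
Proof.
pose x0 := cayley_param 1%:M 1 2.
have -> : cayley_set R = \bigcup_(T in [set T |
  [/\ connected T, T `<=` cayley_set R & T x0]]) T.
  apply/seteqP; split=> [x|x [T [_ + _]]]; last exact.
  move=> /cayley_param_onto[g [p [q [a ->]]]].
  have [T [cT TS T0 T1]] := cayley_arc admissible1 a.
  by exists T.
by apply: bigcup_connected; [exists x0 => T []|move=> T []].
Qed.

End Connected.

Section Pointwise.
Variables (K : numFieldType) (V : normedModType K).
Implicit Types (f g : V -> K) (x : V).

Lemma diff_ptD f g x : differentiable f x -> differentiable g x ->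
  differentiable (fun y => f y + g y) x.
Proof. exact: differentiableD. Qed.

Lemma diff_ptB f g x : differentiable f x -> differentiable g x ->
  differentiable (fun y => f y - g y) x.
Proof. exact: differentiableB. Qed.

Lemma diff_ptM f g x : differentiable f x -> differentiable g x ->
  differentiable (fun y => f y * g y) x.
Proof. exact: differentiableM. Qed.

Lemma diff_ptX f n x : differentiable f x -> differentiable (fun y => f y ^+ n) x.
Proof.
move=> df; elim: n => [|n IH]; first exact: differentiable_cst.
by rewrite (_ : (fun y => _) = (fun y => f y * f y ^+ n));
  [exact: diff_ptM|apply/funext => y; rewrite exprS].
Qed.

Lemma diff_ptV f x : differentiable f x -> f x != 0 ->
  differentiable (fun y => (f y)^-1) x.
Proof. by move=> df f0; exact: differentiableV. Qed.

Lemma near_neq0 f x : differentiable f x -> f x != 0 -> \forall y \near x, f y != 0.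
Proof.
move=> /differentiable_continuous cf f0.
have : nbhs (f x) [set z | z != 0].
  by apply: open_nbhs_nbhs; split => //; exact: open_neq0.
exact: cf.
Qed.

Lemma near_dist1 f x : differentiable f x -> f x = 1 -> \forall y \near x, `|
  f y - 1| < 1.
Proof.
move=> /differentiable_continuous cf f1.
have b1 : nbhs (f x) (ball (f x) 1) by exact: nbhsx_ballx.
have nb : \forall y \near x, ball (f x) 1 (f y) by exact: (cf _ b1).
by apply: filterS nb => y; rewrite f1 -ball_normE /= distrC.
Qed.

End Pointwise.

Lemma Re_gt0_dist1 (K : numClosedFieldType) (z : K) : `|z - 1| < 1 -> 0 < 'Re z.
Proof.
move=> z1; have -> : z = 1 - (1 - z) by rewrite subKr.
rewrite raddfB /= (Creal_ReP 1 _) ?real1// subr_gt0.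
by have [le _] := leif_Re_Creal (1 - z); apply: le_lt_trans le _; rewrite distrC.
Qed.

Section Flattening.
Variables (K : numClosedFieldType) (n : nat) (i : 'I_n).
Variables (Phi A B : 'rV[K]_n -> K) (v0 : 'rV[K]_n).
Hypothesis dPhi : forall v, differentiable Phi v.
Hypothesis dA : forall v, differentiable A v.
Hypothesis dB : forall v, differentiable B v.
Hypothesis quad : forall v h, Phi (v + h *: 'e_i) = Phi v + h * B v + h ^+ 2 * A v.
Hypothesis B0 : B v0 != 0.

Implicit Types (v w : 'rV[K]_n).

Let reset w : 'rV[K]_n := w + (v0 0 i - w 0 i) *: 'e_i.
Let disc w := B (reset w) ^+ 2 + 4 * A (reset w) * (w 0 i - Phi (reset w)).
Let root w := B v0 * csqrt (disc w / B v0 ^+ 2).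
(* The root of [A h^2 + B h + (Phi - y)] vanishing at [Phi = y], written so as to
   make sense also when [A = 0]. *)
Let shift w := 2 * (w 0 i - Phi (reset w)) / (B (reset w) + root w).
Let psi v : 'rV[K]_n := v + (Phi v - v 0 i) *: 'e_i.
Let G w : 'rV[K]_n := reset w + shift w *: 'e_i.

Let two0 : 2 != 0 :> K. Proof. by rewrite pnatr_eq0. Qed.

Let psiE v : psi v 0 i = Phi v.
Proof. by rewrite /psi !mxE !eqxx mulr1 addrC subrK. Qed.

Let reset_id w : w 0 i = v0 0 i -> reset w = w.
Proof. by move=> e; rewrite /reset e subrr scale0r addr0. Qed.

Let reset_addr w h : reset (w + h *: 'e_i) = reset w.
Proof.
rewrite /reset !mxE !eqxx mulr1 -addrA -scalerDl; congr (w + _ *: _).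
by ring.
Qed.

Let d_line (f : 'rV[K]_n -> K) v : differentiable f v ->
  differentiable (fun w => w + f w *: 'e_i) v.
Proof.
move=> df; apply: (@differentiableD _ _ _ id (fun w => f w *: 'e_i)).
  exact: ex_diff.
exact: differentiableZl.
Qed.

Let d_coord v : differentiable (fun w : 'rV[K]_n => w 0 i) v.
Proof. exact: differentiable_coord. Qed.

Let d_reset v : differentiable reset v.
Proof.
by apply: d_line; apply: diff_ptB; [exact: differentiable_cst|exact: d_coord].
Qed.

Let d_comp (f : 'rV[K]_n -> K) v : (forall v, differentiable f v) ->
  differentiable (fun w => f (reset w)) v.
Proof. by move=> df; exact: (differentiable_comp (d_reset v) (df _)). Qed.

Let d_psi v : differentiable psi v.
Proof. by apply: d_line; apply: diff_ptB; [exact: dPhi|exact: d_coord]. Qed.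

Let d_y v : differentiable (fun w => w 0 i - Phi (reset w)) v.
Proof. by apply: diff_ptB; [exact: d_coord|exact: d_comp]. Qed.

Let d_ndisc v : differentiable (fun w => disc w / B v0 ^+ 2) v.
Proof.
apply: diff_ptM; last exact: differentiable_cst.
apply: diff_ptD; first by apply: diff_ptX; exact: d_comp.
apply: diff_ptM; last exact: d_y.
by apply: diff_ptM; [exact: differentiable_cst|exact: d_comp].
Qed.

Let d_root v : `|disc v / B v0 ^+ 2 - 1| < 1 -> differentiable root v.
Proof.
move=> v1; apply: diff_ptM; first exact: differentiable_cst.
have /derivable1_diffP d := csqrt_derivable v1.
exact: (differentiable_comp (d_ndisc v) d).
Qed.

Let d_den v : `|disc v / B v0 ^+ 2 - 1| < 1 ->
  differentiable (fun w => B (reset w) + root w) v.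
Proof. by move=> v1; apply: diff_ptD; [exact: d_comp|exact: d_root]. Qed.

Let reset_psi v : reset (psi v) = reset v.
Proof. exact: reset_addr. Qed.

Let disc0 : disc (psi v0) / B v0 ^+ 2 = 1.
Proof.
by rewrite /disc reset_psi reset_id// psiE subrr mulr0 addr0 divff// expf_neq0.
Qed.

Let root0 : root (psi v0) = B v0.
Proof.
rewrite /root disc0 -[1](expr1n _ 2) sqr_csqrt ?mulr1//.
by rewrite (Creal_ReP 1 _) ?real1.
Qed.

Let near_G : \forall w \near psi v0, differentiable G w /\ psi (G w) = w.
Proof.
have n1 := near_dist1 (d_ndisc (psi v0)) disc0.
have /d_den d0 : `|disc (psi v0) / B v0 ^+ 2 - 1| < 1 by rewrite disc0 subrr normr0.
have /(near_neq0 d0) n2 : B (reset (psi v0)) + root (psi v0) != 0.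
  by rewrite reset_psi reset_id// root0 -mulr2n mulrn_eq0.
apply: filterS2 n1 n2 => w w1 w2; split.
  apply: (@differentiableD _ _ _ reset (fun w => shift w *: 'e_i));
    first exact: d_reset.
  apply: differentiableZl; apply: diff_ptM.
    by apply: diff_ptM; [exact: differentiable_cst|exact: d_y].
  by apply: diff_ptV => //; exact: d_den.
have rE : root w ^+ 2 = disc w.
  by rewrite /root exprMn csqrtK mulrC divfK// expf_neq0.
have PhiG : Phi (G w) = w 0 i.
  rewrite /G quad; move: rE w2; rewrite /shift /disc.
  set r := root w; set b := B _; set a := A _; set p := Phi _; set y := w 0 i => rE w2.
  have -> : p + 2 * (y - p) / (b + r) * b + (2 * (y - p) / (b + r)) ^+ 2 * a =
     p + (y - p) * (2 * b * (b + r) + 4 * a * (y - p)) / (b + r) ^+ 2 by field.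
  have -> : 4 * a * (y - p) = r ^+ 2 - b ^+ 2 by rewrite rE; ring.
  by field.
rewrite /psi PhiG /G /reset !mxE !eqxx !mulr1 -!addrA -!scalerDl.
rewrite [X in X *: _](_ : _ = 0) ?scale0r ?addr0//.
ring.
Qed.

Let near_psi : \forall v \near v0, G (psi v) = v.
Proof.
pose h0 (v : 'rV[K]_n) := v 0 i - v0 0 i.
have dh v : differentiable h0 v.
  by apply: diff_ptB; [exact: d_coord|exact: differentiable_cst].
have h00 : h0 v0 = 0 by rewrite /h0 subrr.
pose e1 v := (B (reset v) + 2 * (A (reset v) * h0 v)) / B v0.
pose e2 v := (B (reset v) + A (reset v) * h0 v).
have dAh v : differentiable (fun v => A (reset v) * h0 v) v.
  by apply: diff_ptM; [exact: d_comp|exact: dh].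
have d1 : differentiable e1 v0.
  apply: diff_ptM; last exact: differentiable_cst.
  apply: diff_ptD; first exact: d_comp.
  by apply: diff_ptM; [exact: differentiable_cst|exact: dAh].
have d2 : differentiable e2 v0 by apply: diff_ptD; [exact: d_comp|exact: dAh].
have n1 : \forall v \near v0, `|e1 v - 1| < 1.
  by apply: near_dist1 => //; rewrite /e1 h00 !mulr0 addr0 reset_id// divff.
have n2 : \forall v \near v0, e2 v != 0.
  by apply: near_neq0 => //; rewrite /e2 h00 mulr0 addr0 reset_id.
apply: filterS2 n1 n2 => v /Re_gt0_dist1 v1 v2.
have vE : v = reset v + h0 v *: 'e_i.
  by rewrite /reset /h0 -addrA -scalerDl addrC subrKA subrr scale0r add0r.
have PhiE : Phi v = Phi (reset v) + h0 v * B (reset v) + h0 v ^+ 2 * A (reset v).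
  by rewrite {1}vE quad.
have dE : disc (psi v) / B v0 ^+ 2 = e1 v ^+ 2.
  rewrite /disc reset_psi psiE PhiE /e1.
  set b := B (reset v); set a := A _; set h := h0 v; set p := Phi _.
  by rewrite expr_div_n; congr (_ / _); ring.
have rE : root (psi v) = B (reset v) + 2 * (A (reset v) * h0 v).
  by rewrite /root dE sqr_csqrt// /e1 mulrC divfK.
rewrite [RHS]vE /G reset_psi; congr (_ + _ *: _).
rewrite /shift rE reset_psi psiE PhiE; move: v2; rewrite /e2.
set b := B (reset v); set a := A _; set h := h0 v; set p := Phi _ => v2.
have -> : b + (b + 2 * (a * h)) = 2 * (b + a * h) by ring.
by field; rewrite v2.
Qed.

Lemma quadratic_flattening (m : 'I_n) : exists psi G : 'rV[K]_n -> 'rV[K]_n,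
  [/\ forall v, differentiable psi v, forall v, psi v 0 m = Phi v,
      \forall v \near v0, G (psi v) = v &
      \forall w \near psi v0, differentiable G w /\ psi (G w) = w].
Proof.
pose T (w : 'rV[K]_n) := w *m tperm_mx i m.
have TT w : T (T w) = w by rewrite /T -mulmxA -perm_mxM tperm2 perm_mx1 mulmx1.
have dT w : differentiable T w by exact: differentiable_mulmxr.
exists (T \o psi), (G \o T); split.
- by move=> v; exact: (differentiable_comp (d_psi v) (dT _)).
- by move=> v; rewrite /= /T -xcolE mxE tpermR psiE.
- by apply: filterS near_psi => v; rewrite /= TT.
- have cT := differentiable_continuous (dT (T (psi v0))).
  have : nbhs (T (T (psi v0))) [set w | differentiable G w /\ psi (G w) = w].
    by rewrite TT; exact: near_G.
  move=> nT.
  have nG : \forall w \near T (psi v0), differentiable G (T w) /\ psi (G (T w)) = T w.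
    exact: (cT _ nT).
  apply: filterS nG => w [dG pG]; split.
    exact: (differentiable_comp (dT w) dG).
  by rewrite /= pG TT.
Qed.

End Flattening.

Section LocalChart.
Variables (R : realType) (M : topologicalType) (n : nat).
Local Notation C := (complexes R).
Variables (A : set (chart R M n)) (al : chart R M n) (x0 : M).
Variables (psi G : 'rV[C]_n -> 'rV[C]_n) (P : set 'rV[C]_n).

Lemma local_chart : complex_manifold A -> A al -> chart_dom al x0 ->
  (forall v, differentiable psi v) ->
  (\forall v \near al x0, P v /\ G (psi v) = v) ->
  (\forall w \near psi (al x0), differentiable G w /\ psi (G w) = w) ->
  exists phi : chart R M n, [/\ maximal_atlas A phi, chart_dom phi x0,
    chart_dom phi `<=` chart_dom al, (forall x, phi x = psi (al x)) &
    forall x, chart_dom phi x -> P (al x)].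
Proof.
move=> [_ _ Ach Acomp _] Aal dx0 dpsi nearv nearw.
have [alo ali alc alU] := Ach _ Aal.
have : nbhs (al x0) [set v | P v /\ G (psi v) = v] := nearv.
rewrite nbhsE => -[N [oN Nx0] NP].
have : nbhs (psi (al x0)) [set w | differentiable G w /\ psi (G w) = w] := nearw.
rewrite nbhsE => -[N' [oN' N'x0] N'P].
pose W := N `&` psi @^-1` N'.
have oW : open W.
  apply: openI => //; apply: open_comp oN' => v _.
  exact: differentiable_continuous.
pose D := chart_dom al `&` al @^-1` W.
have oD : open D.
  rewrite openE => x [dx Wx]; apply: filterI.
    by apply: open_nbhs_nbhs; split.
  apply: (alc x); first by rewrite inE.
  exact: open_nbhs_nbhs.
pose phi : chart R M n := Chart D (psi \o al).
have GK x : D x -> G (psi (al x)) = al x.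
  by move=> [_ [/NP[_ e] _]].
have phich : is_chart phi.
  split; first exact: oD.
  - move=> x y /set_mem Dx /set_mem Dy /= e; apply: ali; rewrite ?inE;
    [exact: Dx.1|exact: Dy.1|].
    by rewrite -(GK _ Dx) -(GK _ Dy) e.
  - move=> x /set_mem Dx; apply: (@continuous_comp _ _ _ al psi).
      by apply: alc; rewrite inE; exact: Dx.1.
    exact: differentiable_continuous.
  - move=> U oU UD; have oalU : open (al @` U) by apply: alU => // x /UD [].
    have -> : phi @` U = N' `&` G @^-1` (al @` U).
      apply/seteqP; split => [_ [x Ux <-]|w [N'w [x Ux e]]].
        have [dx [Nx N'x]] := UD _ Ux; split => //.
        by exists x => //=; rewrite GK//; exact: UD.
      exists x => //=; have [_ pG] := N'P _ N'w; by rewrite e pG.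
    rewrite openE => w [N'w Uw]; apply: filterI; first exact: open_nbhs_nbhs.
    have [dG _] := N'P _ N'w.
    by apply: (differentiable_continuous dG); exact: open_nbhs_nbhs.
exists phi; split; last 2 first.
- by [].
- by move=> x [_ [/NP[]]].
- split=> [|be Abe]; first exact: phich.
  have [[f1 f1E] [f2 f2E]] := Acomp _ _ Aal Abe; split.
    exists (f1 \o G) => x [Dx bx]; have [dx [Nx N'x]] := Dx.
    have [e d] := f1E _ (conj dx bx); split; first by rewrite /= GK.
    have [dG _] := N'P _ N'x; rewrite -(GK _ Dx) in d.
    exact: (differentiable_comp dG d).
  exists (psi \o f2) => x [bx Dx]; have [dx _] := Dx.
  have [e d] := f2E _ (conj bx dx); split; first by rewrite /= e.
  exact: (differentiable_comp d (dpsi _)).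
- by split => //; split => //; exact: N'x0.
- by move=> x [].
Qed.

End LocalChart.

Section DifferentiableForms.
Variables (K : numClosedFieldType) (V : normedModType K).
Implicit Types (f g : V -> 'M[K]_3) (x : V).

Definition differentiable_entries f x :=
  forall i j, differentiable (fun y => f y i j) x.

Lemma differentiable_det f x : differentiable_entries f x ->
  differentiable (fun y => \det (f y)) x.
Proof.
move=> df; rewrite (_ : (fun y => _) = (fun y => let a i j := f y (inord i) (inord j) in
  a 0 0 * (a 1 1 * a 2 2 - a 1 2 * a 2 1) - a 0 1 * (a 1 0 * a 2 2 - a 1 2 * a 2 0)
  + a 0 2 * (a 1 0 * a 2 1 - a 1 1 * a 2 0))); last first.
  by apply/funext => y; rewrite det_mx33.
have minor i j k l i' j' k' l' : differentiable (fun y =>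
    f y i j * f y k l - f y i' j' * f y k' l') x.
  by apply: diff_ptB; apply: diff_ptM; exact: df.
by apply: diff_ptD; [apply: diff_ptB|]; apply: diff_ptM;
  [exact: df|exact: minor|exact: df|exact: minor|exact: df|exact: minor].
Qed.

Lemma differentiable_entriesD f g x : differentiable_entries f x ->
  differentiable_entries g x -> differentiable_entries (fun y => f y + g y) x.
Proof.
move=> df dg i j; rewrite (_ : (fun y => _) = (fun y => f y i j + g y i j)).
  by apply: diff_ptD; [exact: df|exact: dg].
by apply/funext => y; rewrite mxE.
Qed.

Lemma differentiable_entriesB f g x : differentiable_entries f x ->
  differentiable_entries g x -> differentiable_entries (fun y => f y - g y) x.
Proof.
move=> df dg i j; rewrite (_ : (fun y => _) = (fun y => f y i j - g y i j)).
  by apply: diff_ptB; [exact: df|exact: dg].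
by apply/funext => y; rewrite !mxE.
Qed.

Lemma differentiable_sigma f g x : differentiable_entries f x ->
  differentiable_entries g x ->
  differentiable (fun y => sigma21 (f y) (g y)) x /\
  differentiable (fun y => sigma12 (f y) (g y)) x.
Proof.
move=> df dg; have d1 := differentiable_det (differentiable_entriesD df dg).
have d2 := differentiable_det (differentiable_entriesB dg df).
have half (u : V -> K) : differentiable u x -> differentiable (fun y => u y / 2) x.
  by move=> du; apply: diff_ptM; [exact: du|exact: differentiable_cst].
split.
  apply: diff_ptB; last exact: differentiable_det.
  by apply: half; exact: diff_ptD d1 d2.
apply: diff_ptB; last exact: differentiable_det.
by apply: half; exact: diff_ptB d1 d2.
Qed.

Lemma differentiable_cayley_form f g x : differentiable_entries f x ->
  differentiable_entries g x -> differentiable (fun y => cayley_form (f y) (g y)) x.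
Proof.
move=> df dg; have [d1 d2] := differentiable_sigma df dg.
apply: diff_ptB; last exact: diff_ptX.
apply: diff_ptM; last exact: d1.
by apply: diff_ptM; [exact: differentiable_cst|exact: differentiable_det].
Qed.

Lemma differentiable_cayley_polar f W g x : differentiable_entries f x ->
  differentiable_entries g x -> differentiable (fun y => cayley_polar (f y) W (g y)) x.
Proof.
move=> df dg; have dW : differentiable_entries (fun=> W) x.
  by move=> i j; exact: differentiable_cst.
rewrite (_ : (fun y => _) = (fun y => cayley_form (f y + W) (g y)
    - cayley_form (f y) (g y) - cayley_form W (g y))); last first.
  by apply/funext => y; rewrite cayley_polarE.
apply: diff_ptB; last exact: differentiable_cayley_form dW dg.
apply: diff_ptB; last exact: differentiable_cayley_form df dg.
exact: differentiable_cayley_form (differentiable_entriesD df dW) dg.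
Qed.

Lemma differentiable_pencil_disc f g x : differentiable_entries f x ->
  differentiable_entries g x -> differentiable (fun y => pencil_disc (f y) (g y)) x.
Proof.
move=> df dg; have [d1 d2] := differentiable_sigma df dg.
have da := differentiable_det df; have dd := differentiable_det dg.
have dc (k : K) : differentiable (cst k : V -> K) x by exact: differentiable_cst.
apply: diff_ptD; [apply: diff_ptB; [apply: diff_ptB; [apply: diff_ptB|]|]|].
- by apply: diff_ptM; exact: diff_ptX.
- by apply: diff_ptM; [exact: diff_ptM (dc _) da|exact: diff_ptX].
- by apply: diff_ptM; [apply: diff_ptM; [exact: dc|exact: diff_ptX]|exact: dd].
- by apply: diff_ptM; [apply: diff_ptM; [exact: dc|exact: diff_ptX]|exact: diff_ptX].
- exact: diff_ptM (diff_ptM (diff_ptM (diff_ptM (dc _) da) d1) d2) dd.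
Qed.

End DifferentiableForms.

Section Slices.
Variable R : realType.
Local Notation C := (complexes R).
Local Notation atlas := (prod_atlas (conic_atlas R) (conic_atlas R)).

Lemma sym_mxD (u v : 'rV[C]_6) : sym_mx (u + v) = sym_mx u + sym_mx v.
Proof. by apply/matrixP => i j; rewrite !mxE. Qed.

(* By Euler's relation the derivative along the coordinate normalized to 1 is a
   combination of the other ones. *)
Lemma cayley_direction (u : 'rV[C]_6) (D : 'M[C]_3) k : u 0 k = 1 -> D^T = D ->
  cayley_pair (sym_mx u) D ->
  exists j, cayley_polar (sym_mx u) (sym_mx 'e_(lift k j)) D != 0.
Proof.
move=> uk sD [dA dD d0 e]; apply: contrapT => H.
pose L w := cayley_polar (sym_mx u) (sym_mx w) D.
have LD w h w' : L (w + h *: w') = L w + h * L w'.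
  by rewrite /L sym_mxD sym_mxZ cayley_polarD.
have L0 : L 0 = 0.
  have := LD 0 1 0; rewrite scaler0 addr0 mul1r => /eqP.
  by rewrite -[X in X == _]addr0 (inj_eq (addrI _)) eq_sym => /eqP.
have Lsum w : L w = \sum_j w 0 j * L 'e_j.
  rewrite {1}(row_sum_delta w).
  elim/big_rec2: _ => [|j x y _ IH]; first exact: L0.
  by rewrite addrC LD IH addrC.
have Lj j : L 'e_(lift k j) = 0.
  by apply: contrapT => /eqP Lj; apply: H; exists j.
have Lk : L 'e_k = 0.
  have : L u = 0 by exact: cayley_polar_self.
  rewrite Lsum (bigD1 k)/= ?uk ?mul1r; last by [].
  rewrite big1 ?addr0; first by [].
  by move=> j; case: (unliftP k j) => [i ->|->]; rewrite ?eqxx// Lj mulr0.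
have uA : sym_mx u \in unitmx by move: dA; rewrite det_neq0.
have uD : D \in unitmx by move: dD; rewrite det_neq0.
have [g [x [y [z Hs]]]] := simdiag_of_disc (sym_mx_sym u) sD uA uD d0.
have [W [sW /eqP]] := cayley_polar_nondegenerate Hs; apply.
rewrite -(sym_coordsK sW) -[LHS]/(L _) Lsum big1// => j _.
by case: (unliftP k j) => [i ->|->]; rewrite ?Lj ?Lk mulr0.
Qed.

Lemma insert1D k (w : 'rV[C]_5) h j :
  insert1 k (w + h *: 'e_j) = insert1 k w + h *: 'e_(lift k j).
Proof.
apply/rowP => i; rewrite !mxE; case: unliftP => [a ->|->].
  by rewrite !mxE (inj_eq (@lift_inj _ k)).
by rewrite (negPf (neq_lift k j)) andbF mulr0 addr0.
Qed.

Lemma cayley_slice cd : cayley_set R cd ->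
  exists2 phi, @slice_chart R _ 9 1 atlas (cayley_set R) phi & chart_dom phi cd.
Proof.
case: cd => c0 d0 Scd.
have /rV0Pn[k ck] := conic_coords_neq0 c0; have /rV0Pn[l dl] := conic_coords_neq0 d0.
pose al : chart R (conic R * conic R)%type (5 + 5) :=
  prod_chart (affine_chart R k) (affine_chart R l).
pose v0 := al (c0, d0).
pose Am (v : 'rV[C]_(5 + 5)) := sym_mx (insert1 k (lsubmx v)).
pose Dm (v : 'rV[C]_(5 + 5)) := sym_mx (insert1 l (rsubmx v)).
have alP x : chart_dom al x ->
    cayley_set R x <-> cayley_pair (Am (al x)) (Dm (al x)).
  case: x => c d [/= ck' dl']; rewrite /Am /Dm /= row_mxKl row_mxKr.
  have := cayley_set_of (insert1_neq0 k (affine_chart R k c))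
    (insert1_neq0 l (affine_chart R l d)).
  by rewrite (affine_chartK ck') (affine_chartK dl').
have dom0 : chart_dom al (c0, d0) by split.
have cp0 : cayley_pair (Am v0) (Dm v0) by apply/alP.
have [j Bj] : exists j, cayley_polar (Am v0) (sym_mx 'e_(lift k j)) (Dm v0) != 0.
  by apply: cayley_direction => //; [exact: insert1_id|exact: sym_mx_sym].
have dAm v : differentiable_entries Am v.
  move=> a b; rewrite (_ : (fun y => _) = (fun w : 'rV[C]_6 =>
    w 0 (inord (sym_idx a b)))
      \o (insert1 k \o lsubmx)).
    apply: differentiable_comp; last exact: differentiable_coord.
    by apply: differentiable_comp;
      [exact: differentiable_lsubmx|exact: differentiable_insert1].
  by apply/funext => y; rewrite /Am mxE.
have dDm v : differentiable_entries Dm v.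
  move=> a b; rewrite (_ : (fun y => _) = (fun w : 'rV[C]_6 =>
    w 0 (inord (sym_idx a b)))
      \o (insert1 l \o rsubmx)).
    apply: differentiable_comp; last exact: differentiable_coord.
    by apply: differentiable_comp;
      [exact: differentiable_rsubmx|exact: differentiable_insert1].
  by apply/funext => y; rewrite /Dm mxE.
pose E : 'M[C]_3 := sym_mx 'e_(lift k j).
have dE v : differentiable_entries (fun _ : 'rV[C]_(5 + 5) => E) v.
  by move=> a b; exact: differentiable_cst.
pose Phi v := cayley_form (Am v) (Dm v).
have quad v h : Phi (v + h *: 'e_(lshift 5 j)) =
    Phi v + h * cayley_polar (Am v) E (Dm v) + h ^+ 2 * cayley_form E (Dm v).
  have lE : lsubmx (v + h *: 'e_(lshift 5 j)) = lsubmx v + h *: 'e_j.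
    by apply/rowP => a; rewrite !mxE eq_lshift.
  have rE : rsubmx (v + h *: 'e_(lshift 5 j)) = rsubmx v.
    by apply/rowP => a; rewrite !mxE eq_rlshift andbF mulr0 addr0.
  have eA : Am (v + h *: 'e_(lshift 5 j)) = Am v + h *: E.
    by rewrite /Am lE insert1D sym_mxD sym_mxZ.
  have eD : Dm (v + h *: 'e_(lshift 5 j)) = Dm v by rewrite /Dm rE.
  by rewrite /Phi eA eD cayley_formD.
pose m : 'I_(5 + 5) := (rshift 9 (ord0 : 'I_1) : 'I_(9 + 1)).
have [psi [G [dpsi psim near1 near2]]] := quadratic_flattening
  (fun v => differentiable_cayley_form (dAm v) (dDm v))
  (fun v => differentiable_cayley_form (dE v) (dDm v))
  (fun v => differentiable_cayley_polar E (dAm v) (dDm v)) quad Bj m.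
have [n1 n2 n3 _] := cp0.
pose P v := [/\ \det (Am v) != 0, \det (Dm v) != 0 & pencil_disc (Am v) (Dm v) != 0].
have nearP : \forall v \near v0, P v /\ G (psi v) = v.
  have a1 := near_neq0 (differentiable_det (dAm v0)) n1.
  have a2 := near_neq0 (differentiable_det (dDm v0)) n2.
  have a3 := near_neq0 (differentiable_pencil_disc (dAm v0) (dDm v0)) n3.
  apply: filterS2 (filterI a1 a2) (filterI a3 near1) => v [b1 b2] [b3 b4].
  by split; first split.
have Mprod := prod_manifold (conic_manifold R) (conic_manifold R).
have Aal : atlas al by exists (affine_chart R k);
  [exists k|exists (affine_chart R l); [exists l|]].
have [phi [mphi dphi domphi phiE phiP]] := local_chart Mprod Aal dom0 dpsi nearP near2.
have SE x : chart_dom phi x -> cayley_set R x <-> @rsubmx C 1 9 1 (phi x) = 0.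
  move=> dx; rewrite (alP _ (domphi _ dx)).
  have e : phi x 0 m = cayley_form (Am (al x)) (Dm (al x)) by rewrite phiE psim.
  split=> [[_ _ _ f]|/rowP/(_ ord0)].
    by apply/rowP => a; rewrite !ord1 mxE -[LHS]/(phi x 0 m) e f mxE.
  rewrite !mxE -[LHS]/(phi x 0 m) e => f; have [? ? ?] := phiP _ dx.
  by split.
exists phi => //; split; first exact: mphi.
apply/seteqP; split => [_ [x [dx /(SE _ dx) Sx] <-]|_ [[x dx <-] /= Sx]].
  by split => //; exists x.
by exists x => //; split => //; apply/(SE _ dx).
Qed.

End Slices.

Theorem corollary1 (R : realType) :
  [/\ cayley_set R !=set0,
      connected (cayley_set R) &
      complex_manifold
        (@induced_atlas R (conic R * conic R)%type 9 1
           (prod_atlas (conic_atlas R) (conic_atlas R)) (cayley_set R))].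
Proof.
split; [exact: cayley_set_neq0|exact: cayley_set_connected|].
apply: induced_atlas_manifold; last exact: cayley_slice.
exact: prod_manifold (conic_manifold R) (conic_manifold R).
Qed.
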